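(* Let $K$ be a field, $S=K[x_1,\ldots,x_n]$, and $d\ge 2$ an integer. Let $u=x_1^{a_1}\cdots x_n^{a_n}$ with $a_1>0$ and $v=x_1^{b_1}\cdots x_n^{b_n}$ be monomials of degree $d$ with $u\ge_{\mathrm{lex}} v$, and let $I=(L(u,v))\subset S$ be the lexsegment ideal determined by $u$ and $v$. Then the following statements are equivalent: (1) $I$ has a linear resolution. (2) $I$ has linear quotients. (3) All the powers $I^N$, $N\ge 1$, have linear quotients. (4) All the powers $I^N$, $N\ge 1$, have a linear resolution.
   Context: The lexicographic order on monomials is taken with $x_1>x_2>\cdots>x_n$. For monomials $u\ge_{\mathrm{lex}}v$ of degree $d$, $L(u,v)=\{w : w \text{ a monomial of degree } d,\ u\ge_{\mathrm{lex}}w\ge_{\mathrm{lex}}v\}$, and the lexsegment ideal $(L(u,v))$ is the ideal of $S$ generated by this set. A monomial ideal $J$ has linear quotients if its minimal monomial generators can be ordered $w_1,\ldots,w_r$ so that for every $2\le i\le r$ the colon ideal $(w_1,\ldots,w_{i-1}):w_i$ is generated by a subset of the variables. An ideal generated in a single degree $e$ has a linear resolution if its minimal graded free resolution over $S$ is $e$-linear. *)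

(* Defs.v *)
From mathcomp Require Export all_boot all_order all_algebra.
From mathcomp Require Export mpoly.

Set Implicit Arguments.
Unset Strict Implicit.
Unset Printing Implicit Defensive.

Import Order.TTheory GRing.Theory.
Local Open Scope ring_scope.

(* Ideals are propositional predicates on the ring. *)

Definition ideal_gen (R : comNzRingType) (G : R -> Prop) : R -> Prop :=
  fun p => exists (k : nat) (c g : 'I_k -> R),
    (forall i, G (g i)) /\ p = \sum_(i < k) c i * g i.

Definition ideal_mul (R : comNzRingType) (I J : R -> Prop) : R -> Prop :=
  ideal_gen (fun p => exists a b, I a /\ J b /\ p = a * b).

Fixpoint ideal_pow (R : comNzRingType) (I : R -> Prop) (N : nat) : R -> Prop :=
  if N is N'.+1 then ideal_mul I (ideal_pow I N') else fun _ => True.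

Definition colon (R : comNzRingType) (J : R -> Prop) (f : R) : R -> Prop :=
  fun p => J (p * f).

(* Exponent vectors are compared as sequences, first entry first, so that
   x_0 > x_1 > ... ; the canonical order on 'X_{1..n} is graded instead. *)
Definition lexm (n : nat) (m1 m2 : 'X_{1..n}) : bool :=
  ((m1 : seqlexi nat) <= (m2 : seqlexi nat))%O.

Definition lexsegment (n : nat) (u v : 'X_{1..n}) : pred 'X_{1..n} :=
  fun w => [&& mdeg w == mdeg u, lexm w u & lexm v w].

Definition monomial_gen (K : fieldType) (n : nat) (A : 'X_{1..n} -> Prop) :
    {mpoly K[n]} -> Prop :=
  ideal_gen (fun p => exists2 w, A w & p = 'X_[w]).
Arguments monomial_gen K {n} A p.

Definition lexsegment_ideal (K : fieldType) (n : nat) (u v : 'X_{1..n}) :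
    {mpoly K[n]} -> Prop :=
  monomial_gen K (fun w => w \in lexsegment u v).
Arguments lexsegment_ideal K {n} u v p.

Definition monomial_ideal (K : fieldType) (n : nat)
    (J : {mpoly K[n]} -> Prop) : Prop :=
  exists A : 'X_{1..n} -> Prop, forall p, J p <-> monomial_gen K A p.

Definition min_monomial_gen (K : fieldType) (n : nat)
    (J : {mpoly K[n]} -> Prop) (m : 'X_{1..n}) : Prop :=
  J 'X_[m] /\ forall m' : 'X_{1..n}, J 'X_[m'] -> (m' <= m)%MM -> m' = m.

Definition linear_quotients (K : fieldType) (n : nat)
    (J : {mpoly K[n]} -> Prop) : Prop :=
  monomial_ideal J /\
  exists w : seq 'X_{1..n},
    [/\ uniq w,
        forall m, m \in w <-> min_monomial_gen J m &
        forall i, (0 < i < size w)%N ->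
          exists A : {set 'I_n}, forall p : {mpoly K[n]},
            colon (monomial_gen K (fun m => m \in take i w))
                  'X_[nth 0%MM w i] p
            <-> ideal_gen (fun q => exists2 j, j \in A & q = 'X_j) p].

(* F_i is the free module with basis indexed by 'I_(rk i), the j-th basis
   element having degree sh i j, i.e. F_i = \bigoplus_j S(- sh i j).  Elements
   are row vectors; dif i : F_(i+1) -> F_i and aug : F_0 -> S act by right
   multiplication.  Natural-number shifts suffice for ideals of S, whose
   minimal resolutions have no negative shifts. *)
Record free_complex (K : fieldType) (n : nat) := FreeComplex {
  rk : nat -> nat;
  sh : forall i, 'I_(rk i) -> nat;
  dif : forall i, 'M[{mpoly K[n]}]_(rk i.+1, rk i);
  aug : 'cV[{mpoly K[n]}]_(rk 0)
}.

(* All the maps are homogeneous of degree 0: an entry is zero or homogeneous of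
   degree the difference of the degrees of the two basis elements. *)
Definition graded_maps (K : fieldType) (n : nat) (F : free_complex K n) : Prop :=
  (forall (j : 'I_(rk F 0)) m, m \in msupp (aug F j 0) -> mdeg m = sh j) /\
  (forall i (j : 'I_(rk F i.+1)) (k : 'I_(rk F i)) m,
     m \in msupp (dif F i j k) -> (mdeg m + sh k)%N = sh j).

Definition resolves (K : fieldType) (n : nat) (F : free_complex K n)
    (J : {mpoly K[n]} -> Prop) : Prop :=
  [/\ forall p, J p <-> exists x : 'rV_(rk F 0), p = (x *m aug F) 0 0,
      forall x : 'rV_(rk F 0),
        x *m aug F = 0 <-> exists y : 'rV_(rk F 1), x = y *m dif F 0 &
      forall i (x : 'rV_(rk F i.+1)),
        x *m dif F i = 0 <-> exists y : 'rV_(rk F i.+2), x = y *m dif F i.+1].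

(* dif i maps F_(i+1) into (x_0, ..., x_(n-1)) F_i. *)
Definition minimal (K : fieldType) (n : nat) (F : free_complex K n) : Prop :=
  forall i (j : 'I_(rk F i.+1)) (k : 'I_(rk F i)), (dif F i j k)@_0%MM = 0.

Definition minimal_graded_free_resolution (K : fieldType) (n : nat)
    (F : free_complex K n) (J : {mpoly K[n]} -> Prop) : Prop :=
  [/\ graded_maps F, resolves F J & minimal F].

Definition linear_shifts (K : fieldType) (n : nat) (e : nat)
    (F : free_complex K n) : Prop :=
  forall i (j : 'I_(rk F i)), sh j = (e + i)%N.

Definition generated_in_degree (K : fieldType) (n : nat) (e : nat)
    (J : {mpoly K[n]} -> Prop) : Prop :=
  exists G : {mpoly K[n]} -> Prop,
    (forall g, G g -> g \is e.-homog) /\ forall p, J p <-> ideal_gen G p.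

(* The minimal graded free resolution is unique up to isomorphism, so it may be
   quantified existentially. *)
Definition linear_resolution (K : fieldType) (n : nat)
    (J : {mpoly K[n]} -> Prop) : Prop :=
  exists e : nat, generated_in_degree e J /\
    exists F : free_complex K n,
      minimal_graded_free_resolution F J /\ linear_shifts e F.

(* Main.v *)
Require Import Defs.
From mathcomp Require Import zify.

(* Dividing by a common monomial, one may assume that [v] involves only variables after
   some [x_o] while [u] is divisible by [x_o]; write [L] for the segment.

   Linear resolution => condition on [u] and [v].  Tensoring a linear resolution with the
   Koszul complex shows that every Koszul cycle over the ideal of nonlinear degree is a
   boundary.  Applied to the cycles [d (x^m e_A)] this forces one of two shapes.  Either
   (1) for every [l] in [L] and [o < t < r] with [x_r | l], one of [x_t l / x_o] and
   [x_t l / x_r] is in [L]; or (2) [L] consists of [x_o B], for a final lexsegment [B] in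
   the variables from some [x_mu] on, and of all the monomials in the variables after
   [x_o] that involve a variable before [x_mu].

   Condition => linear quotients of the powers.  The generators of [I^N] are ordered by
   increasing degree in [x_o], and then lexicographically, decreasingly in case (1) and
   increasingly in case (2).  Both conditions pass to products of members of [L].  In case
   (1) the remaining point is that [x_o^j w] with [w] in [C^(N-j) B^j], where [C] is an
   initial and [B] a final lexsegment, depends only on the sorted list of the variables
   of [w]: its head has to lie in [C^(N-j)] and its tail in [B^j].

   Linear quotients => linear resolution.  If a module has linear quotients with respect
   to [z_1, ..., z_r], so has its module of syzygies: each variable [x_j] in the colon
   ideal of [z_k] gives a syzygy with leading term [x_j e_k], and these, ordered by
   [(k, j)], have colon ideals generated by variables.  Iterating gives the resolution. *)

Set Implicit Arguments.
Unset Strict Implicit.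
Unset Printing Implicit Defensive.

Import Order.TTheory GRing.Theory.

(** * Exchange of variables in monomials, and products of members of a set of monomials *)

Section Moves.
Variable n : nat.
Implicit Types (g h l m : 'X_{1..n}) (L : 'X_{1..n} -> Prop) (s r t i : 'I_n).

(* [x_s m / x_r]; the subtraction is truncated when [x_r] does not divide [m]. *)
Definition move (s r : 'I_n) (m : 'X_{1..n}) : 'X_{1..n} := (m + U_(s) - U_(r))%MM.

Lemma moveE s r m i : move s r m i = (m i + (s == i) - (r == i))%N.
Proof. by rewrite mnmBE mnmDE !mnm1E. Qed.

Lemma move_neq s r m i : s != i -> r != i -> move s r m i = m i.
Proof. by rewrite moveE => /negbTE-> /negbTE->; rewrite addn0 subn0. Qed.

Lemma move_s s r m : s != r -> move s r m s = (m s).+1.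
Proof. by rewrite moveE eqxx eq_sym => /negbTE->; rewrite addn1 subn0. Qed.

Lemma move_r s r m : s != r -> move s r m r = (m r).-1.
Proof. by rewrite moveE eqxx => /negbTE->; rewrite addn0 subn1. Qed.

Lemma moveDl s r g h : (0 < g r)%N -> move s r (g + h)%MM = (move s r g + h)%MM.
Proof.
by move=> g_r; apply/mnmP=> i; rewrite mnmDE !moveE mnmDE; case: (r =P i) => [<-|_]; lia.
Qed.

Lemma moveDr s r g h : (0 < h r)%N -> move s r (g + h)%MM = (g + move s r h)%MM.
Proof. by move=> h_r; rewrite addmC moveDl // addmC. Qed.

Lemma move_add s r m : (0 < m r)%N -> (move s r m + U_(r))%MM = (m + U_(s))%MM.
Proof.
move=> m_r; apply/mnmP=> i; rewrite !mnmDE moveE !mnm1E.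
by case: (r =P i) => [<-|_]; lia.
Qed.

Lemma mdeg_move s r m : (0 < m r)%N -> mdeg (move s r m) = mdeg m.
Proof.
move=> m_r; have := congr1 mdeg (move_add s m_r).
by rewrite !mdegD !mdeg1 => /addIn.
Qed.

Lemma mdeg_lt_ex g h (P : pred 'I_n) : (forall i, ~~ P i -> g i = h i) ->
  (mdeg g < mdeg h)%N -> exists2 i, P i & (g i < h i)%N.
Proof.
move=> eq_gh lt_gh; apply/exists_inP; apply: contraLR lt_gh.
move=> /exists_inPn le_hg; rewrite -leqNgt !mdegE leq_sum // => i _.
by have [/le_hg|/eq_gh->] := boolP (P i); rewrite // -leqNgt.
Qed.

(** As [g] has no larger degree, its excess at [t] is compensated at another index, which lies in
    [P] since elsewhere the two agree. *)
Lemma mdeg_le_ex g h (P : pred 'I_n) t : (forall i, ~~ P i -> i != t -> g i = h i) ->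
  (mdeg g <= mdeg h)%N -> (h t < g t)%N -> exists2 i, P i && (i != t) & (g i < h i)%N.
Proof.
move=> eq_gh le_gh lt_t; apply/exists_inP; apply: contraLR le_gh.
move=> /exists_inPn le_hg; rewrite -ltnNge !mdegE (bigD1 t) //= [in X in (_ < X)%N](bigD1 t) //=.
rewrite -addSn leq_add // leq_sum // => i it.
have [Pi|/eq_gh->] := boolP (P i) => //.
by rewrite leqNgt; apply: le_hg; rewrite unfold_in /= Pi it.
Qed.

(** The comparison is made at the first differing index, whatever the degrees; in equal degree it is
    the canonical order on monomials. *)
Definition lexlt (g h : 'X_{1..n}) : Prop :=
  exists2 t : 'I_n, (forall i : 'I_n, (i < t)%N -> g i = h i) & (g t < h t)%N.

Lemma lexlt_move_up s r m : (s < r)%N -> lexlt m (move s r m).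
Proof.
move=> lt_sr; have ne : s != r by rewrite neq_ltn lt_sr.
exists s => [i lt_is|]; last by rewrite move_s.
by rewrite move_neq // eq_sym neq_ltn ?lt_is // (ltn_trans lt_is).
Qed.

Lemma lexlt_move_down s r m : (s < r)%N -> (0 < m s)%N -> lexlt (move r s m) m.
Proof.
move=> lt_sr m_s; have ne : r != s by rewrite eq_sym neq_ltn lt_sr.
exists s => [i lt_is|]; last by rewrite move_r // ltn_predL.
by rewrite move_neq // eq_sym neq_ltn ?lt_is // (ltn_trans lt_is).
Qed.

(* The monomial generators of the [N]-th power of the ideal generated by [L]. *)
Fixpoint mpow L N m : Prop :=
  if N is N'.+1 then exists a b, [/\ L a, mpow L N' b & m = (a + b)%MM] else m = 0%MM.

Lemma mpow1 L m : mpow L 1 m <-> L m.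
Proof.
split=> [[a [b [La -> ->]]]|Lm]; first by rewrite addm0.
by exists m, 0%MM; rewrite addm0.
Qed.

Lemma mdeg_mpow L d N m : (forall l, L l -> mdeg l = d) -> mpow L N m -> mdeg m = (N * d)%N.
Proof.
move=> Ld; elim: N m => [|N IH] m; first by move=> ->; rewrite mdeg0.
by case=> a [b [/Ld da /IH db ->]]; rewrite mdegD da db mulSn.
Qed.

Lemma mpowD L p q a b : mpow L p a -> mpow L q b -> mpow L (p + q) (a + b)%MM.
Proof.
elim: p a => [|p IH] a; first by move=> ->; rewrite add0m.
case=> x [y [Lx Ly ->]] Lb; exists x, (y + b)%MM; split=> //; first exact: IH.
by rewrite addmA.
Qed.

Lemma mpow_sub L L' N m : (forall l, L l -> L' l) -> mpow L N m -> mpow L' N m.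
Proof.
move=> LL'; elim: N m => [|N IH] m //= [a [b [/LL' La /IH Lb ->]]].
by exists a, b.
Qed.

Lemma mpow_eq0 L N m (i : 'I_n) : (forall l, L l -> l i = 0%N) -> mpow L N m -> m i = 0%N.
Proof.
move=> L0; elim: N m => [|N IH] m; first by move=> ->; rewrite mnm0E.
by case=> a [b [/L0 a0 /IH b0 ->]]; rewrite mnmDE a0 b0.
Qed.

(** The exchange is made in a single factor divisible by [x_r]. *)
Lemma mpow_move L s r N m : (forall l, L l -> (0 < l r)%N -> L (move s r l)) ->
  mpow L N m -> (0 < m r)%N -> mpow L N (move s r m).
Proof.
move=> Lmv; elim: N m => [|N IH] m; first by move=> ->; rewrite mnm0E.
case=> a [b [La Lb ->]]; rewrite mnmDE addn_gt0.
case: (posnP (a r)) => [_ b_r|a_r _].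
  by rewrite moveDr //; exists a, (move s r b); split=> //; apply: IH.
by rewrite moveDl //; exists (move s r a), b; split=> //; apply: Lmv.
Qed.

Lemma mpow_le L p q m : (q <= p)%N -> mpow L p m ->
  exists2 m', mpow L q m' & (m' <= m)%MM.
Proof.
elim: p q m => [|p IH] [|q] m //= pq.
- by move=> ->; exists 0%MM => //; exact: lepm_refl.
- by move=> _; exists 0%MM => //; apply/mnm_lepP=> i; rewrite mnm0E.
- case=> a [b [La Lb ->]]; have [m' Lm' le_m'] := IH q b pq Lb.
  exists (a + m')%MM; first by exists a, m'.
  by apply/mnm_lepP=> i; rewrite !mnmDE leq_add2l; move/mnm_lepP: le_m'; apply.
Qed.

(** Membership of [x^m] in the ideal generated by [L]. *)
Definition divby L m := exists2 l, L l & (l <= m)%MM.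

(* The trace on monomials of the vanishing of nonlinear Koszul homology: if the cycle
   [d (x^m e_A)] has coefficients in the ideal generated by [L], it is a boundary over
   that ideal, and its coefficient at [A :\ a] is [x_a x^m] up to sign. *)
Definition koszul_condition d L := forall (A : {set 'I_n}) m,
  (d <= mdeg m)%N -> (forall a : 'I_n, a \in A -> divby L (m + U_(a))%MM) ->
  forall a : 'I_n, a \in A -> divby L m \/
    exists t, [/\ t \notin A, (0 < m t)%N & divby L (move a t m)].

Lemma lem_eq g h : (g <= h)%MM -> mdeg g = mdeg h -> g = h.
Proof.
move=> gh dgh; have := submK gh; suff /eqP-> : (h - g == 0)%MM by rewrite add0m.
by rewrite -mdeg_eq0; have := congr1 mdeg (submK gh); rewrite mdegD -dgh; lia.
Qed.

Lemma move_lem s t m : (0 < m t)%N -> (move s t m <= m + U_(s))%MM.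
Proof. by move=> m_t; rewrite -(move_add s m_t) lem_addr. Qed.


End Moves.

(** * Powers when non-members of the segment can be exchanged with [x_o] *)

(* [x_o] plays the role of [x_1]: the members of [L] involve only variables from [x_o]
   on.  [C] and [B] are the members of degree 0 and 1 in [x_o], the latter divided by
   [x_o]. *)
Section FirstCase.
Variables (n d : nat) (o : 'I_n) (L : 'X_{1..n} -> Prop).
Implicit Types (g h l m : 'X_{1..n}) (s r t i : 'I_n).
Hypothesis L_low : forall l s, L l -> (s < o)%N -> l s = 0%N.
Hypothesis L_deg : forall l, L l -> mdeg l = d.
Hypothesis L_up : forall l s t, L l -> l o = 0%N -> (o < s)%N -> (s < t)%N ->
  (0 < l t)%N -> L (move s t l).
Hypothesis L_exch : forall l t r, L l -> (o < t)%N -> (t < r)%N -> (0 < l r)%N ->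
  (0 < l o)%N /\ L (move t o l) \/ L (move t r l).
Hypothesis L_lower : forall l s, L l -> (1 < l o)%N -> (o < s)%N -> L (move s o l).
Hypothesis L_down : forall l s t, L l -> l o = 1%N -> (o < s)%N -> (s < t)%N ->
  (0 < l s)%N -> L (move t s l).

Let C l := L l /\ l o = 0%N.
Let B b := L (b + U_(o))%MM /\ b o = 0%N.

(** Only one factor is changed, one that is divisible by [x_r]. *)
Lemma mpow_exch N g t r : mpow L N g -> (o < t)%N -> (t < r)%N -> (0 < g r)%N ->
  (0 < g o)%N /\ mpow L N (move t o g) \/ mpow L N (move t r g).
Proof.
move=> Lg ot tr; elim: N g Lg => [|N IH] g; first by move=> ->; rewrite mnm0E.
case=> a [b [La Lb ->]]; rewrite !mnmDE addn_gt0.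
case: (posnP (a r)) => [_ b_r|a_r _].
  have [[b_o Lb']|Lb'] := IH b Lb b_r; [left|right].
    by rewrite addn_gt0 b_o orbT; split=> //; rewrite moveDr //; exists a, (move t o b).
  by rewrite moveDr //; exists a, (move t r b).
have [[a_o La']|La'] := L_exch La ot tr a_r; [left|right].
  by rewrite addn_gt0 a_o; split=> //; rewrite moveDl //; exists (move t o a), b.
by rewrite moveDl //; exists (move t r a), b.
Qed.

(** If a factor is divisible by [x_o^2], [L_lower] replaces one [x_o] in it by any later variable.
    Otherwise the factors are sorted into members of [C] and of [x_o B]. *)
Lemma mpow_split N g : mpow L N g ->
  (forall s, (o < s)%N -> (0 < g o)%N /\ mpow L N (move s o g)) \/
  exists p j Q R, [/\ N = (p + j)%N, mpow C p Q, mpow B j R & g = (Q + R + U_(o) *+ j)%MM].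
Proof.
elim: N g => [|N IH] g.
  by move=> ->; right; exists 0%N, 0%N, 0%MM, 0%MM; rewrite mulm0n !addm0.
case=> a [b [La Lb ->]]; have [IHb|[p [j [Q [R [EN CQ BR Eb]]]]]] := IH b Lb.
  left=> s os; have [b_o Lb'] := IHb s os.
  by rewrite mnmDE addn_gt0 b_o orbT moveDr //; split=> //; exists a, (move s o b).
subst N b; have [a_o|a_o|a_o] := ltngtP (a o) 1%N.
- right; exists p.+1, j, (a + Q)%MM, R; split=> //; last by rewrite !addmA.
  by exists a, Q; split=> //; split=> //; case: (a o) a_o.
- left=> s os; rewrite mnmDE addn_gt0 (ltnW a_o) moveDl ?(ltnW a_o) //; split=> //.
  by exists (move s o a), (Q + R + U_(o) *+ j)%MM; split=> //; exact: L_lower.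
- right; exists p, j.+1, Q, (a - U_(o) + R)%MM; split=> //; first by rewrite addnS.
    exists (a - U_(o))%MM, R; split=> //; split.
      by rewrite submK // lep1mP a_o.
    by rewrite mnmBE mnm1E eqxx a_o.
  apply/mnmP=> i; rewrite !mnmDE mnmBE !mulmnE !mnm1E.
  by case: (o =P i) => [<-|_]; [rewrite a_o|]; lia.
Qed.

(** [Q] is the product of the factors free of [x_o]; each of the others contributes at least 1 to
    [h o]. *)
Lemma mpow_head N h : mpow L N h ->
  exists p Q, [/\ mpow C p Q, (Q <= h)%MM & (N <= p + h o)%N].
Proof.
elim: N h => [|N IH] h; first move=> _.
  by exists 0%N, 0%MM; split=> //; apply/mnm_lepP=> i; rewrite mnm0E.
case=> a [b [La Lb ->]]; have [p [Q [CQ Qb pN]]] := IH b Lb.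
have [a_o|a_o] := posnP (a o).
  exists p.+1, (a + Q)%MM; split; last by rewrite mnmDE a_o addSn ltnS.
    by exists a, Q.
  by apply/mnm_lepP=> i; rewrite !mnmDE leq_add2l; move/mnm_lepP: Qb; apply.
exists p, Q; split=> //; last by rewrite mnmDE addnCA -add1n leq_add.
by apply: lepm_trans Qb _; rewrite lem_addl.
Qed.

Lemma C_up l s t : (o < s)%N -> (s < t)%N -> C l -> (0 < l t)%N -> C (move s t l).
Proof.
move=> os st [Ll l_o] l_t; split; first exact: L_up.
by rewrite move_neq // neq_ltn ?os ?(ltn_trans os st) ?orbT.
Qed.

Lemma B_down b s t : (o < s)%N -> (s < t)%N -> B b -> (0 < b s)%N -> B (move t s b).
Proof.
move=> os st [Lb b_o] b_s; split; last first.
  by rewrite move_neq // neq_ltn ?os ?(ltn_trans os st) ?orbT.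
rewrite -moveDl //; apply: L_down => //; first by rewrite mnmDE b_o mnm1E eqxx.
by rewrite mnmDE addn_gt0 b_s.
Qed.

Lemma C_low l s : C l -> (s <= o)%N -> l s = 0%N.
Proof.
by move=> [Ll l_o]; rewrite leq_eqVlt => /predU1P[/val_inj->|/L_low->].
Qed.

Lemma B_low b s : B b -> (s <= o)%N -> b s = 0%N.
Proof.
move=> [Ll l_o]; rewrite leq_eqVlt => /predU1P[/val_inj->//|so].
by have := L_low Ll so; rewrite mnmDE => /eqP; rewrite addn_eq0 => /andP[/eqP].
Qed.

(* If [Q] lies componentwise before [Q'] in the order of the variables, then [Q'] is
   transformed into [Q] by replacing variables by earlier ones. *)
Lemma C_dom p Q' Q t0 : mpow C p Q' -> mdeg Q = mdeg Q' ->
  (forall s, (s < t0)%N -> (Q' s <= Q s)%N) -> (forall s, (t0 < s)%N -> Q s = 0%N) ->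
  (forall s, (s <= o)%N -> Q s = 0%N) -> mpow C p Q.
Proof.
(* Induction on the total excess of [Q'] over [Q], the subtraction being truncated. *)
move=> + + + Qhi Qlo; have [k] := ubnP (mdeg (Q' - Q)); elim: k Q' => // k IH Q' lt_k CQ' dQ le_Q.
have [Q'Q|/forallPn[t]] := boolP [forall t, (Q' t <= Q t)%N].
  suff -> : Q = Q' by [].
  have le : (Q' <= Q)%MM by apply/mnm_lepP=> i; move/forallP: Q'Q; apply.
  have := submK le => <-; suff /eqP -> : (Q - Q' == 0)%MM by rewrite add0m.
  rewrite -mdeg_eq0; have := congr1 mdeg (submK le); rewrite mdegD dQ.
  by move/eqP; rewrite -{2}[mdeg Q']add0n eqn_add2r.
rewrite -ltnNge => lt_t.
(* [Q] vanishes after [t0] and dominates [Q'] before it, so a deficit [s] and an excess [t] of [Q']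
   satisfy [s <= t0 <= t]. *)
have [s /andP[_ st] lt_s] : exists2 s, xpredT s && (s != t) & (Q' s < Q s)%N.
  by apply: mdeg_le_ex lt_t; rewrite ?dQ.
have t0t : (t0 <= t)%N by rewrite leqNgt; apply: contraL lt_t => /le_Q; rewrite leqNgt.
have st0 : (s <= t0)%N by rewrite leqNgt; apply: contraL lt_s => /Qhi->.
have os : (o < s)%N by rewrite ltnNge; apply: contraL lt_s => /Qlo->.
have lt_st : (s < t)%N by rewrite ltn_neqAle (leq_trans st0 t0t) andbT.
have Q't : (0 < Q' t)%N by apply: leq_ltn_trans lt_t.
apply: (IH (move s t Q')).
- suff E : (move s t Q' - Q + U_(t) = Q' - Q)%MM by rewrite -E mdegD mdeg1 addn1 in lt_k.
  apply/mnmP=> i; rewrite mnmDE !mnmBE mnmDE !mnm1E.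
  case: (t =P i) => [<-|_]; first by rewrite (negbTE st); lia.
  by case: (s =P i) => [<-|_]; lia.
- by apply: mpow_move => // l; apply: C_up.
- by rewrite mdeg_move.
- move=> i it0; rewrite moveE; case: (t =P i) => [E|_]; first by rewrite -E ltnNge t0t in it0.
  by case: (s =P i) => [<-|_]; rewrite ?subn0 ?addn1 ?addn0 // le_Q.
Qed.

Lemma mnmwgt_move s r m : (0 < m r)%N -> (mnmwgt (move s r m) + r = mnmwgt m + s)%N.
Proof.
move=> m_r; have := congr1 (@mnmwgt n) (move_add s m_r).
by rewrite !mnmwgtD !mnmwgt1; lia.
Qed.

(* Swapping variables pushes the later ones into the factor [R], keeping it in [B^j]. *)
Lemma B_tail j P R : mpow B j R -> exists P' R',
  [/\ (P' + R' = P + R)%MM, mpow B j R', mdeg P' = mdeg P &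
      forall s t, (0 < P' s)%N -> (0 < R' t)%N -> (s <= t)%N].
Proof.
(* Each swap brings an earlier variable into [P], so the sum of the positions of its variables
   drops. *)
have [k] := ubnP (mnmwgt P); elim: k P R => // k IH P R lt_k BR.
have [/existsP[s /existsP[t /and3P[P_s R_t ts]]]|ok] :=
  boolP [exists s, exists t : 'I_n, [&& 0 < P s, 0 < R t & t < s]%N]; last first.
  exists P, R; split=> // s t P_s R_t; rewrite leqNgt; apply: contra ok => ts.
  by apply/existsP; exists s; apply/existsP; exists t; rewrite P_s R_t.
have ot : (o < t)%N.
  rewrite ltnNge; apply: contraL R_t => to; rewrite -eqn0Ngt; apply/eqP.
  by apply: mpow_eq0 BR => b Bb; apply: B_low.
have [P' [R' [E BR' dP' ok]]] : exists P' R',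
  [/\ (P' + R' = move t s P + move s t R)%MM, mpow B j R', mdeg P' = mdeg (move t s P) &
      forall s t, (0 < P' s)%N -> (0 < R' t)%N -> (s <= t)%N].
  apply: IH; first by have := mnmwgt_move t P_s; lia.
  by apply: mpow_move => // l; apply: B_down.
exists P', R'; split=> //; last by rewrite dP' mdeg_move.
rewrite E; apply/mnmP=> i; rewrite !mnmDE !moveE.
by case: (s =P i) => [<-|_]; case: (t =P _) => [<-|_]; lia.
Qed.

Lemma mpow_BL j R : mpow B j R -> mpow L j (R + U_(o) *+ j)%MM.
Proof.
elim: j R => [|j IH] R; first by move=> ->; rewrite mulm0n addm0.
case=> b [R' [[Lb _] BR ->]]; exists (b + U_(o))%MM, (R' + U_(o) *+ j)%MM.
split=> //; first exact: IH.
by apply/mnmP=> i; rewrite !mnmDE !mulmnE mulnS; lia.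
Qed.

(** Let [g] be the product of [Q] in [C^p] and of [j + 1] factors from [x_o B]. As [h] has smaller
    degree in [x_o], it has a divisor [Q'] in [C^(p+1)]. After sorting, the variables of
    [x_s0 g / x_o] split into a tail in [B^j] and a head [P'] that dominates [Q'] before its last
    variable, so that [P'] lies in [C^(p+1)]. *)
Lemma mpow_raise N g h s0 : mpow L N g -> mpow L N h -> (h o < g o)%N ->
  (o < s0)%N -> (g s0 < h s0)%N ->
  (forall s, (o < s)%N -> (s < s0)%N -> (h s <= g s)%N) ->
  (forall s, (s0 < s)%N -> g s = 0%N) -> mpow L N (move s0 o g).
Proof.
move=> Lg Lh lt_o os0 lt_s0 le_hg g_hi.
have [/(_ s0 os0)[]//|[p [[|j] [Q [R [EN CQ BR Eg]]]]]] := mpow_split Lg.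
  have Q_o : Q o = 0%N by apply: mpow_eq0 CQ => l [].
  by move: lt_o; rewrite Eg /= BR mulm0n !addm0 Q_o.
case: BR => b [R1 [Bb BR1 ER]].
have [p0 [Q0 [CQ0 le_Q0 le_N]]] := mpow_head Lh.
have Q_o : Q o = 0%N by apply: mpow_eq0 CQ => l [].
have R1_o : R1 o = 0%N by apply: mpow_eq0 BR1 => l [].
have b_o : b o = 0%N by case: Bb.
have g_o : g o = j.+1 by rewrite Eg ER !mnmDE Q_o b_o R1_o mulmnE mnm1E eqxx mul1n.
have pp0 : (p < p0)%N by move: le_N lt_o; rewrite EN g_o; lia.
have [Q' CQ' le_Q'] := mpow_le pp0 CQ0.
have le_Q'h : (Q' <= h)%MM by apply: lepm_trans le_Q' le_Q0.
(* One factor [x_o b] gives up its [x_o]; what is left of it joins the head together with the new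
   variable [x_s0]. *)
have [P' [R' [EP BR' dP' ord]]] := B_tail (Q + b + U_(s0))%MM BR1.
have EPg s : s != o -> ((P' + R')%MM s = g s + (s0 == s))%N.
  move=> so; rewrite EP Eg ER !mnmDE mulmnE !mnm1E eq_sym in so *.
  by rewrite (negbTE so); lia.
have P'le s : (P' s <= (P' + R')%MM s)%N by rewrite mnmDE leq_addr.
have P'low s : (s <= o)%N -> P' s = 0%N.
  move=> so; apply/eqP; rewrite -leqn0 (leq_trans (P'le s)) // EP !mnmDE mnm1E.
  rewrite (B_low Bb so) (@mpow_eq0 _ C p Q s _ CQ) => [|l /C_low->//].
  rewrite (@mpow_eq0 _ B j R1 s _ BR1) => [|l /B_low->//].
  by case: (s0 =P s) => // E; rewrite -E leqNgt os0 in so.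
have [t0 P't0 P't0max] : exists2 t0, (0 < P' t0)%N & forall s, (t0 < s)%N -> P' s = 0%N.
  have /exists_inP[i0 _ P'i0] : [exists i in 'I_n, 0 < P' i]%N.
    apply: contraT => /exists_inPn P'0.
    suff : mdeg P' = 0%N by rewrite dP' !mdegD mdeg1 addn1.
    by rewrite mdegE big1 // => i _; apply/eqP; rewrite eqn0Ngt P'0.
  case: (@arg_maxnP _ i0 (fun i => 0 < P' i)%N (fun i => i : nat)) => // t0 P't0 max_t0.
  exists t0 => // s; rewrite ltnNge => lt; apply/eqP; rewrite eqn0Ngt.
  by apply: contra lt => /max_t0.
have t0s0 : (t0 <= s0)%N.
  rewrite leqNgt; apply: contraL P't0 => lt; rewrite -eqn0Ngt -leqn0 (leq_trans (P'le _)) //.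
  have so : t0 != o by rewrite neq_ltn (ltn_trans os0 lt) orbT.
  by rewrite EPg // g_hi //; case: (s0 =P t0) => // E; rewrite E ltnn in lt.
have db : (mdeg b).+1 = d by case: Bb => /L_deg <- _; rewrite mdegD mdeg1 addn1.
have CP' : mpow C p.+1 P'.
  apply: (C_dom (t0 := t0) CQ') => //.
    rewrite dP' !mdegD mdeg1 (mdeg_mpow (d := d) _ CQ) => [|l [/L_deg]//].
    rewrite (mdeg_mpow (d := d) _ CQ') => [|l [/L_deg]//].
    by rewrite mulSn -db; lia.
  move=> s st0; have [so|os] := leqP s o.
    by rewrite (@mpow_eq0 _ C p.+1 Q' s _ CQ') // => l /C_low->.
  (* A variable of [R'] before [x_t0], which divides [P'], would contradict the sorting. So before
     [x_t0] the exponents of [P'] are those of [g], and these dominate [h]. *)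
  have R's : R' s = 0%N.
    by apply/eqP; rewrite eqn0Ngt; apply: contraL st0 => R's; rewrite -leqNgt (ord t0 s).
  have so : s != o by rewrite neq_ltn os orbT.
  have ss0 : (s < s0)%N by apply: leq_trans st0 t0s0.
  have := EPg s so; rewrite mnmDE R's addn0 => ->.
  by apply: leq_trans (leq_addr _ _); apply: leq_trans (le_hg s os ss0); apply/mnm_lepP.
have -> : N = (p.+1 + j)%N by rewrite EN addnS.
have -> : (move s0 o g = P' + (R' + U_(o) *+ j))%MM.
  apply/mnmP=> i; rewrite moveE addmA mnmDE EP Eg ER !mnmDE !mulmnE !mnm1E.
  by case: (o =P i) => [<-|_]; rewrite ?mul1n ?mul0n; lia.
by apply: mpowD; [apply: mpow_sub CP' => l []|apply: mpow_BL].
Qed.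

(** The order of the first case, with [h] preceding [g]: increasing degree in [x_o], then
    lexicographically decreasing. *)
Definition before_up h g := (h o < g o)%N \/ h o = g o /\ lexlt g h.

Lemma mpow_low N m s : mpow L N m -> (s < o)%N -> m s = 0%N.
Proof. by move=> Lm so; apply: mpow_eq0 Lm => l Ll; apply: L_low. Qed.

(** The variable [x_s] divides [h / gcd(g, h)] and lies in the colon ideal at [g], because the
    earlier generator [x_s g / x_r] divides [x_s g]. *)
Lemma before_up_exch N g h : mpow L N g -> mpow L N h -> before_up h g ->
  exists s r, [/\ (g s < h s)%N, s != r, (0 < g r)%N, mpow L N (move s r g) &
    before_up (move s r g) g].
Proof.
move=> Lg Lh hg; have dgh : mdeg g = mdeg h by rewrite (mdeg_mpow L_deg Lg) (mdeg_mpow L_deg Lh).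
have down s : (o < s)%N -> (0 < g o)%N -> before_up (move s o g) g.
  by move=> os g_o; left; rewrite move_r ?neq_ltn ?os ?orbT // ltn_predL.
have exch t r : (o < t)%N -> (t < r)%N -> (0 < g r)%N -> (g t < h t)%N ->
  exists s r, [/\ (g s < h s)%N, s != r, (0 < g r)%N, mpow L N (move s r g) &
    before_up (move s r g) g].
  move=> ot tr g_r lt_t; have [[g_o Lg']|Lg'] := mpow_exch Lg ot tr g_r.
    by exists t, o; split=> //; [rewrite neq_ltn ot orbT|apply: down].
  exists t, r; split=> //; first by rewrite neq_ltn tr.
  right; split; last exact: lexlt_move_up.
  by rewrite move_neq // neq_ltn ?ot ?(ltn_trans ot tr) orbT.
case: hg => [lt_o|[eq_o [t eq_t lt_t]]]; last first.
  have ot : (o < t)%N.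
    rewrite ltnNge leq_eqVlt; apply/negP=> /predU1P[/val_inj E|to]; last first.
      by rewrite (mpow_low Lh to) in lt_t.
    by rewrite E eq_o ltnn in lt_t.
  have [r /andP[tr _] lt_r] : exists2 r : 'I_n, (t < r)%N && (r != t) & (h r < g r)%N.
    apply: mdeg_le_ex lt_t; last by rewrite dgh.
    move=> i; rewrite -leqNgt leq_eqVlt => /predU1P[/val_inj->|/eq_t->//].
    by rewrite eqxx.
  by apply: (exch t r) => //; apply: leq_ltn_trans lt_r.
have g_o : (0 < g o)%N by apply: leq_ltn_trans lt_o.
have [/existsP[t /existsP[r /and4P[]]]|none] :=
  boolP [exists t : 'I_n, exists r : 'I_n, [&& o < t, t < r, 0 < g r & g t < h t]%N].
  exact: exch.
have [s1 os1 lt_s1] : exists2 s : 'I_n, (o < s)%N & (g s < h s)%N.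
  have [s /andP[os _] lt_s] : exists2 s : 'I_n, (o < s)%N && (s != o) & (g s < h s)%N.
    apply: mdeg_le_ex lt_o; last by rewrite dgh.
    move=> i; rewrite -leqNgt leq_eqVlt => /predU1P[/val_inj->|io _]; first by rewrite eqxx.
    by rewrite (mpow_low Lh io) (mpow_low Lg io).
  by exists s.
(* For the first deficit [s0] after [x_o], [none] excludes variables of [g] after [x_s0], as
   [mpow_raise] requires. *)
case: (@arg_minnP _ s1 (fun i => (o < i) && (g i < h i))%N (fun i => i : nat)).
  by rewrite os1.
move=> s0 /andP[os0 lt_s0] min_s0.
exists s0, o; split=> //; [by rewrite neq_ltn os0 orbT| |exact: down].
apply: mpow_raise Lh _ _ _ _ _ => //.
  by move=> s os; apply: contraTT; rewrite -!ltnNge ltnS => lt_s; apply: min_s0; rewrite os.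
move=> r s0r; apply/eqP; rewrite eqn0Ngt; apply: contra none => g_r.
by apply/existsP; exists s0; apply/existsP; exists r; apply/and4P.
Qed.

End FirstCase.

(** * Powers of the remaining segments with linear resolution *)

(* [L] consists of [x_o B] and of the monomials in the variables after [x_o] that involve
   some [x_s] with [o < s < mu], whereas [B] involves only variables from [x_mu] on. *)
Section SecondCase.
Variables (n d : nat) (o mu : 'I_n) (L : 'X_{1..n} -> Prop).
Implicit Types (g h l m a b : 'X_{1..n}) (s r t i : 'I_n).

Definition small s := (o < s)%N && (s < mu)%N.

Hypothesis L_low : forall l s, L l -> (s < o)%N -> l s = 0%N.
Hypothesis L_deg : forall l, L l -> mdeg l = d.
Hypothesis L_le1 : forall l, L l -> (l o <= 1)%N.
Hypothesis L_1 : forall l s, L l -> l o = 1%N -> small s -> l s = 0%N.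
Hypothesis L_0 : forall l, L l -> l o = 0%N -> exists2 s, small s & (0 < l s)%N.
Hypothesis L_small : forall l s, mdeg l = d -> (forall i, (i <= o)%N -> l i = 0%N) ->
  small s -> (0 < l s)%N -> L l.
Hypothesis L_down : forall l s t, L l -> l o = 1%N -> (o < s)%N -> (s < t)%N ->
  (0 < l s)%N -> L (move t s l).

Definition sdeg m := (\sum_(s | small s) m s)%N.

Lemma sdegD a b : sdeg (a + b)%MM = (sdeg a + sdeg b)%N.
Proof. by rewrite /sdeg -big_split; apply: eq_bigr => i _; rewrite mnmDE. Qed.

Lemma sdeg1 s : sdeg U_(s)%MM = small s.
Proof.
rewrite /sdeg; case: (boolP (small s)) => ss.
  rewrite (bigD1 s) //= mnm1E eqxx big1 // => i /andP[_ /negbTE].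
  by rewrite mnm1E eq_sym => ->.
rewrite big1 // => i si; rewrite mnm1E; case: eqP => // E.
by rewrite E si in ss.
Qed.

Lemma sdeg_move s t m : (0 < m t)%N -> (sdeg (move s t m) + small t = sdeg m + small s)%N.
Proof. by move=> m_t; rewrite -!sdeg1 -!sdegD move_add. Qed.

Lemma sdeg_gt0 m : (0 < sdeg m)%N -> exists2 s, small s & (0 < m s)%N.
Proof.
move=> m_gt0; apply/exists_inP; apply: contraLR m_gt0 => /exists_inPn m0.
by rewrite -eqn0Ngt sum_nat_eq0; apply/forall_inP => i /m0; rewrite -eqn0Ngt.
Qed.

Lemma small_gt s : small s -> (o < s)%N. Proof. by case/andP. Qed.

Lemma small_neq s : small s -> o != s.
Proof. by move=> /small_gt os; rewrite neq_ltn os. Qed.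

Lemma L_low0 l s : L l -> l o = 0%N -> (s <= o)%N -> l s = 0%N.
Proof. by move=> Ll l_o; rewrite leq_eqVlt => /predU1P[/val_inj->|/L_low->]. Qed.

Lemma L_o l s : L l -> small s -> (0 < l s)%N -> l o = 0%N.
Proof.
move=> Ll ss l_s; case: (posnP (l o)) => // l_o.
have l1 : l o = 1%N by apply/eqP; rewrite eqn_leq L_le1.
by rewrite (L_1 Ll l1 ss) in l_s.
Qed.

Lemma L_move_o l s : L l -> (0 < l o)%N -> small s -> L (move s o l).
Proof.
move=> Ll l_o ss; have so : s != o by rewrite eq_sym small_neq.
have l1 : l o = 1%N by apply/eqP; rewrite eqn_leq L_le1.
apply: L_small (ss) _; [by rewrite mdeg_move // L_deg| |by rewrite move_s].
move=> i; rewrite leq_eqVlt => /predU1P[/val_inj->|io]; first by rewrite move_r // l1.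
rewrite move_neq ?(L_low Ll io) // neq_ltn ?io ?orbT //.
by rewrite (ltn_trans io) ?orbT // small_gt.
Qed.

Lemma L_move0 l s t s' : L l -> l o = 0%N -> (o < s)%N -> (0 < l t)%N ->
  small s' -> (0 < move s t l s')%N -> L (move s t l).
Proof.
move=> Ll l_o os l_t ss' l_s'; apply: L_small ss' l_s'; first by rewrite mdeg_move // L_deg.
move=> i io; rewrite moveE (L_low0 Ll l_o io) //.
by case: (s =P i) => // E; rewrite -E leqNgt os in io.
Qed.

Lemma L_move_up l s t : L l -> (o < t)%N -> (t < s)%N -> (mu <= t)%N -> (0 < l t)%N ->
  L (move s t l).
Proof.
move=> Ll ot ts mut l_t; have [l_o|l_o] := posnP (l o); last first.
  by apply: L_down => //; apply/eqP; rewrite eqn_leq L_le1.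
have [s' ss' l_s'] := L_0 Ll l_o; apply: (L_move0 (s' := s')) => //; first exact: ltn_trans ts.
rewrite moveE; case: (t =P s') => [E|_]; last by rewrite subn0 addn_gt0 l_s'.
by move: ss'; rewrite /small -E [(t < mu)%N]ltnNge mut andbF.
Qed.

Lemma L_move_small l s t : L l -> small s -> small t -> (0 < l t)%N -> L (move s t l).
Proof.
move=> Ll ss st l_t; apply: (L_move0 (s' := s)) => //; [exact: L_o l_t|exact: small_gt|].
by rewrite moveE eqxx; case: (t =P s) => [<-|_]; lia.
Qed.

Lemma L_move_sdeg l s t : L l -> (1 < sdeg l)%N -> small t -> (0 < l t)%N -> (o < s)%N ->
  L (move s t l).
Proof.
move=> Ll l2 st l_t os; have [|s' ss' l_s'] := @sdeg_gt0 (move s t l).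
  by have := sdeg_move s l_t; rewrite st; lia.
by apply: L_move0 ss' l_s' => //; apply: L_o l_t.
Qed.

(* [g o + sdeg g - N] is the number of small variables of [g] that can be spared. *)
Lemma mpow_sdeg N g : mpow L N g -> (g o <= N)%N /\ (N <= g o + sdeg g)%N.
Proof.
elim: N g => [|N IH] g; first by move=> ->; rewrite mnm0E.
case=> a [b [La /IH[b1 b2] ->]]; rewrite mnmDE sdegD.
have := L_le1 La; have : (0 < a o + sdeg a)%N; last by lia.
rewrite addn_gt0; have [a_o|//] := posnP (a o).
by have [s ss a_s] := L_0 La a_o; rewrite /sdeg (bigD1 s) //= addn_gt0 a_s.
Qed.

Lemma mpow_move_small N g s t : mpow L N g -> small s -> small t -> (0 < g t)%N ->
  mpow L N (move s t g).
Proof. by move=> Lg ss st; apply: mpow_move Lg => l Ll; apply: L_move_small. Qed.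

(** A factor with two small variables can give one up for any variable after [x_o]. If the spare
    variable is not in the factor that contains [x_t], the two factors first swap [x_t] with another
    small variable. *)
Lemma mpow_move_sdeg N g s t : mpow L N g -> (N < g o + sdeg g)%N -> small t ->
  (0 < g t)%N -> (o < s)%N -> mpow L N (move s t g).
Proof.
move=> + + + + os; elim: N g t => [|N IH] g t; first by move=> ->; rewrite !mnm0E.
case=> a [b [La Lb ->]]; rewrite !mnmDE sdegD addn_gt0 => lt_N st.
have [b_o b_N] := mpow_sdeg Lb; have a_1 := L_le1 La.
case: (posnP (a t)) => [a_t b_t|a_t _].
  case: (ltnP N (b o + sdeg b)) => ltN.
    by exists a, (move s t b); split=> //; [exact: IH|rewrite moveDr].
  (* Here [b] has no variable to spare, so [a] has at least two small ones and is free of [x_o]. *)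
  have a_o : a o = 0%N.
    case: (posnP (a o)) => // a_o; have a1 : a o = 1%N by lia.
    have : sdeg a = 0%N by apply: big1 => i; apply: L_1.
    by lia.
  have a2 : (1 < sdeg a)%N by lia.
  have [t' st' a_t'] := sdeg_gt0 (ltnW a2).
  exists (move s t' a), (move t' t b); split; [exact: L_move_sdeg|exact: mpow_move_small|].
  apply/mnmP=> i; rewrite mnmDE !moveE mnmDE.
  by case: (t' =P i) => [?|_]; [subst i|]; case: (t =P _) => [?|_]; [subst t'| |subst i|]; lia.
have a_o := L_o La st a_t.
case: (ltnP 1 (sdeg a)) => a2.
  by exists (move s t a), b; split=> //; [exact: L_move_sdeg|rewrite moveDl].
have [t' st' b_t'] : exists2 t', small t' & (0 < b t')%N by apply: sdeg_gt0; lia.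
exists (move t' t a), (move s t' b); split; [exact: L_move_small|apply: IH => //; lia|].
apply/mnmP=> i; rewrite mnmDE !moveE mnmDE.
by case: (t' =P i) => [?|_]; [subst i|]; case: (t =P _) => [?|_]; [subst t'| |subst i|]; lia.
Qed.

(** First [x_o] is replaced by a small variable [x_t], which preserves [g o + sdeg g]; then one
    [x_t] is replaced by [x_s]. *)
Lemma mpow_move_o N g s : mpow L N g -> (N < g o + sdeg g)%N -> (0 < g o)%N ->
  (o < s)%N -> mpow L N (move s o g).
Proof.
move=> Lg lt_N g_o os; have [go_N _] := mpow_sdeg Lg.
have [t st g_t] : exists2 t, small t & (0 < g t)%N by apply: sdeg_gt0; lia.
have to : t != o by rewrite eq_sym small_neq.
have -> : move s o g = move s t (move t o g).
  apply/mnmP=> i; rewrite !moveE; case: (t =P i) => [<-|_].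
    by rewrite (eq_sym o t) (negbTE to) ?eqxx; lia.
  by case: (o =P i) => [<-|_]; lia.
apply: mpow_move_sdeg => //; last by rewrite move_s.
  by apply: mpow_move Lg g_o => l Ll l_o; apply: L_move_o.
by have := sdeg_move t g_o; rewrite move_r // st /small ltnn; lia.
Qed.

(** The order of the second case, with [h] preceding [g]: increasing degree in [x_o], then
    lexicographically increasing. *)
Definition before_down h g := (h o < g o)%N \/ h o = g o /\ lexlt h g.

Lemma before_down_exch N g h : mpow L N g -> mpow L N h -> before_down h g ->
  exists s r, [/\ (g s < h s)%N, s != r, (0 < g r)%N, mpow L N (move s r g) &
    before_down (move s r g) g].
Proof.
move=> Lg Lh hg; have dgh : mdeg g = mdeg h by rewrite (mdeg_mpow L_deg Lg) (mdeg_mpow L_deg Lh).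
have low m s : mpow L N m -> (s < o)%N -> m s = 0%N.
  by move=> Lm so; apply: mpow_eq0 Lm => l Ll; apply: L_low.
have [[gN Ng] [hN Nh]] := (mpow_sdeg Lg, mpow_sdeg Lh).
case: hg => [lt_o|[eq_o [t eq_t lt_t]]].
  have g_o : (0 < g o)%N by apply: leq_ltn_trans lt_o.
  have down s : (o < s)%N -> before_down (move s o g) g.
    by move=> os; left; rewrite move_r ?neq_ltn ?os ?orbT // ltn_predL.
  have [/exists_inP[s ss lt_s]|/exists_inPn ge] := boolP [exists s in small, g s < h s]%N.
    exists s, o; split=> //; [by rewrite eq_sym small_neq| |exact/down/small_gt].
    by apply: mpow_move Lg g_o => l Ll l_o; apply: L_move_o.
  (* Without a deficit at a small variable, [N <= h o + sdeg h < g o + sdeg g], so [g] has a small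
     variable to spare. *)
  have le_sdeg : (sdeg h <= sdeg g)%N by apply: leq_sum => i si; rewrite leqNgt ge.
  have [s /andP[os _] lt_s] : exists2 s : 'I_n, (o < s)%N && (s != o) & (g s < h s)%N.
    apply: mdeg_le_ex lt_o; last by rewrite dgh.
    move=> i; rewrite -leqNgt leq_eqVlt => /predU1P[/val_inj->|io _]; first by rewrite eqxx.
    by rewrite (low _ _ Lh io) (low _ _ Lg io).
  exists s, o; split=> //; [by rewrite neq_ltn os orbT| |exact: down].
  by apply: mpow_move_o => //; lia.
have g_t : (0 < g t)%N by apply: leq_ltn_trans lt_t.
have ot : (o < t)%N.
  rewrite ltnNge leq_eqVlt; apply/negP=> /predU1P[/val_inj E|to]; last first.
    by rewrite (low _ _ Lg to) in g_t.
  by rewrite E eq_o ltnn in lt_t.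
have gt_t s : s != t -> (g s < h s)%N -> (t < s)%N.
  move=> st lt_s; rewrite ltnNge leq_eqVlt; apply/negP=> /predU1P[/val_inj E|/eq_t E].
    by rewrite E eqxx in st.
  by rewrite E ltnn in lt_s.
have before s : (t < s)%N -> before_down (move s t g) g.
  move=> ts; right; split; last exact: lexlt_move_down.
  by rewrite move_neq // neq_ltn ?ot ?(ltn_trans ot ts) orbT.
have [s /andP[_ st] lt_s] : exists2 s, xpredT s && (s != t) & (g s < h s)%N.
  by apply: mdeg_le_ex lt_t; rewrite ?dgh.
have [mut|tmu] := leqP mu t.
  have ts := gt_t s st lt_s; exists s, t; split=> //; last exact: before.
  by apply: mpow_move Lg g_t => l Ll l_t; apply: L_move_up.
have small_t : small t by rewrite /small ot.
have [/exists_inP[s' ss' lt_s']|/exists_inPn ge] := boolP [exists s in small, g s < h s]%N.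
  have s't : s' != t by apply: contraTneq lt_s' => ->; rewrite -leqNgt ltnW.
  exists s', t; split=> //; [exact: mpow_move_small|exact/before/gt_t].
have ts := gt_t s st lt_s; exists s, t; split=> //; last exact: before.
apply: mpow_move_sdeg => //; last exact: ltn_trans ts.
(* The degrees in [x_o] agree, and [g] exceeds [h] at the small variable [x_t]: again one can be
   spared. *)
suff : (sdeg h < sdeg g)%N by lia.
rewrite /sdeg (bigD1 t) //= [X in (_ < X)%N](bigD1 t) //= -addSn leq_add //.
by apply: leq_sum => i /andP[si _]; rewrite leqNgt ge.
Qed.

End SecondCase.

(** * Lexsegments satisfying the Koszul condition *)

Section Lexsegment.
Variables (n d : nat) (o : 'I_n.+1) (u v : 'X_{1..n.+1}).
Implicit Types (g h l m a b c w : 'X_{1..n.+1}) (s r t i q mu : 'I_n.+1).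
Hypothesis u_low : forall s, (s < o)%N -> u s = 0%N.
Hypothesis v_low : forall s, (s <= o)%N -> v s = 0%N.
Hypothesis u_o : (0 < u o)%N.
Hypotheses (du : mdeg u = d) (dv : mdeg v = d).

(** In the fixed degree [d], the canonical graded order is the lexicographic one. *)
Definition between m := [&& mdeg m == d, (m <= u)%O & (v <= m)%O].
Let L m : Prop := between m.

Lemma lexlt_lt g h : mdeg g = mdeg h -> lexlt g h -> (g < h)%O.
Proof. by move=> E gh; apply/(ltmcP E). Qed.

Lemma lt_lexlt g h : mdeg g = mdeg h -> (g < h)%O -> lexlt g h.
Proof. by move=> E gh; apply/(ltmcP E). Qed.

Lemma between_deg l : L l -> mdeg l = d.
Proof. by case/and3P=> /eqP. Qed.

Lemma le_lexlt l : L l -> l = u \/ lexlt l u.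
Proof.
move=> Ll; case/and3P: (Ll) => /eqP dl; rewrite le_eqVlt => /predU1P[->|lu _]; first by left.
by right; apply: lt_lexlt lu; rewrite dl.
Qed.

Lemma between_low l s : L l -> (s < o)%N -> l s = 0%N.
Proof.
move=> /le_lexlt[->|[t eq_t lt_t]] so; first exact: u_low.
rewrite eq_t ?u_low // (leq_trans so) // leqNgt; apply: contraL lt_t => to.
by rewrite (u_low to).
Qed.

Lemma between_le_u l : L l -> (l o <= u o)%N.
Proof.
move=> /le_lexlt[->//|[s eq_s lt_s]]; have [so|os|/val_inj<-] := ltngtP s o; last exact: ltnW.
  by rewrite (u_low so) in lt_s.
by rewrite eq_s.
Qed.

(** As [v] is free of [x_o], only the upper bound is a condition on monomials divisible by [x_o];
    for monomials in the variables after [x_o] only the lower bound is. *)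
Lemma between_o m : mdeg m = d -> (forall s, (s < o)%N -> m s = 0%N) -> (0 < m o)%N ->
  (m <= u)%O -> L m.
Proof.
move=> dm m_low m_o mu; rewrite /L /between dm eqxx mu ltW // lexlt_lt ?dv //.
by exists o => [i io|]; [rewrite m_low // v_low // ltnW|rewrite v_low].
Qed.

Lemma between_no m : mdeg m = d -> (forall s, (s <= o)%N -> m s = 0%N) ->
  (v <= m)%O -> L m.
Proof.
move=> dm m_low vm; rewrite /L /between dm eqxx vm ltW // lexlt_lt ?du //.
by exists o => [i io|]; [rewrite u_low // m_low // ltnW|rewrite m_low].
Qed.

Lemma move_up_lt s r m : (s < r)%N -> (0 < m r)%N -> (m < move s r m)%O.
Proof. by move=> sr m_r; apply: lexlt_lt (lexlt_move_up m sr); rewrite mdeg_move. Qed.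

Lemma move_down_lt s r m : (s < r)%N -> (0 < m s)%N -> (move r s m < m)%O.
Proof. by move=> sr m_s; apply: lexlt_lt (lexlt_move_down sr m_s); rewrite mdeg_move. Qed.

Lemma move_low s r m i : (o < s)%N -> (o < r)%N -> (i <= o)%N -> move s r m i = m i.
Proof. by move=> os or io; rewrite move_neq // neq_ltn ?(leq_ltn_trans io) ?orbT. Qed.

Lemma between_le_o l s : L l -> l o = 0%N -> (s <= o)%N -> l s = 0%N.
Proof. by move=> Ll l_o; rewrite leq_eqVlt => /predU1P[/val_inj->|/(between_low Ll)]. Qed.

Lemma between_up l s t : L l -> l o = 0%N -> (o < s)%N -> (s < t)%N -> (0 < l t)%N ->
  L (move s t l).
Proof.
move=> Ll l_o os st l_t; apply: between_no; first by rewrite mdeg_move // between_deg.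
  by move=> i io; rewrite move_low ?(ltn_trans os st) // (between_le_o Ll).
by case/and3P: Ll => _ _ vl; apply: le_trans vl (ltW (move_up_lt st l_t)).
Qed.

Lemma between_lower l s : L l -> (1 < l o)%N -> (o < s)%N -> L (move s o l).
Proof.
move=> Ll l_o os; have so : s != o by rewrite neq_ltn os orbT.
apply: between_o; first by rewrite mdeg_move ?between_deg // ltnW.
- move=> i io; rewrite move_neq ?(between_low Ll) // neq_ltn ?io ?orbT //.
  by rewrite (ltn_trans io os) orbT.
- by rewrite move_r //; lia.
- case/and3P: Ll => _ lu _; apply: le_trans lu; apply/ltW/move_down_lt => //.
  exact: ltnW.
Qed.

Lemma between_down l s t : L l -> l o = 1%N -> (o < s)%N -> (s < t)%N -> (0 < l s)%N ->
  L (move t s l).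
Proof.
move=> Ll l_o os st l_s; have ot := ltn_trans os st.
apply: between_o; first by rewrite mdeg_move ?between_deg.
- by move=> i io; rewrite move_low ?(between_low Ll) // ltnW.
- by rewrite move_low ?l_o.
- by case/and3P: Ll => _ lu _; apply: le_trans lu; apply/ltW/move_down_lt.
Qed.

(** If [0 < l o < u o], the exponent of [x_o] alone keeps [x_t l / x_r] below [u]; if
    [l o = u o >= 2], one [x_o] can be given up. *)
Lemma between_exch2 l t r : (1 < u o)%N -> L l -> (o < t)%N -> (t < r)%N -> (0 < l r)%N ->
  (0 < l o)%N /\ L (move t o l) \/ L (move t r l).
Proof.
move=> u_o2 Ll ot tr l_r; have [l_o|l_o] := posnP (l o).
  by right; apply: between_up.
have or := ltn_trans ot tr.
have [l_u|u_l] := ltnP (l o) (u o).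
  right; apply: between_o; first by rewrite mdeg_move // between_deg.
  - by move=> i io; rewrite move_low ?(between_low Ll) // ltnW.
  - by rewrite move_low.
  - apply/ltW/lexlt_lt; first by rewrite mdeg_move // (between_deg Ll).
    exists o => [i io|]; last by rewrite move_low.
    by rewrite move_low ?(between_low Ll) ?u_low // ltnW.
by left; split=> //; apply: between_lower => //; apply: leq_trans u_l.
Qed.

(** With [b = x_t l / (x_o x_r)], the two candidates are [x_o b] and [x_r b], and the latter is at
    least the product of [b] with the last variable. *)
Lemma between_exch1 l t r : u o = 1%N ->
  (forall b, (mdeg b).+1 = d -> (forall s, (s <= o)%N -> b s = 0%N) ->
    L (b + U_(o))%MM \/ L (b + U_(ord_max))%MM) ->
  L l -> (o < t)%N -> (t < r)%N -> (0 < l r)%N ->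
  (0 < l o)%N /\ L (move t o l) \/ L (move t r l).
Proof.
move=> u_o1 ok Ll ot tr l_r; have [l_o|l_o] := posnP (l o).
  by right; apply: between_up.
have or := ltn_trans ot tr; have [to ro] : t != o /\ r != o by rewrite !neq_ltn ot or !orbT.
have l_o1 : l o = 1%N.
  by apply/eqP; rewrite eqn_leq l_o andbT -u_o1 between_le_u.
pose b := (move t r l - U_(o))%MM.
have Eb : (b + U_(o) = move t r l)%MM by rewrite submK // lep1mP move_low ?l_o1.
have Eb' : (b + U_(r) = move t o l)%MM.
  apply/mnmP=> i; rewrite mnmDE mnmBE !moveE !mnm1E.
  case: (o =P i) => [<-|_]; first by rewrite (negbTE to) (negbTE ro) l_o1.
  by case: (r =P i) => [<-|_]; lia.
have db : (mdeg b).+1 = d.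
  by have := congr1 mdeg Eb; rewrite mdegD mdeg1 addn1 => ->; rewrite mdeg_move // between_deg.
have b_low s : (s <= o)%N -> b s = 0%N.
  rewrite leq_eqVlt => /predU1P[/val_inj->|so].
    by rewrite mnmBE move_low // l_o1 mnm1E eqxx.
  by rewrite mnmBE move_low ?(between_low Ll) // ltnW.
have [|Lb] := ok b db b_low; first by rewrite Eb; right.
left; split=> //; rewrite -Eb'; apply: between_no; first by rewrite mdegD mdeg1 addn1.
  move=> s so; rewrite mnmDE b_low // mnm1E; case: (r =P s) => // E.
  by rewrite -E leqNgt or in so.
case/and3P: Lb => dbm _ vb; apply: le_trans vb _.
have [->//|rm] := eqVneq r ord_max.
apply/ltW/lexlt_lt; first by rewrite !mdegD !mdeg1.
have rm' : (r < @ord_max n)%N by rewrite ltn_neqAle rm leq_ord.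
exists r => [i ir|]; rewrite !mnmDE !mnm1E.
  case: (r =P i) => [E|_]; first by rewrite E ltnn in ir.
  by case: (ord_max =P i) => [E|//]; rewrite -E ltnNge (leq_ord r) in ir.
by rewrite eqxx (eq_sym _ r) (negbTE rm) ltn_add2l.
Qed.

Lemma divby_deg m : divby L m -> mdeg m = d -> L m.
Proof. by move=> [l Ll lm] dm; rewrite -(lem_eq lm) // dm (between_deg Ll). Qed.


(** * Test monomials for the Koszul condition *)

Definition high m := forall s, (s <= o)%N -> m s = 0%N.

(** There are finitely many monomials of degree [d], so a largest one below [v] in the variables
    after [x_o] exists; the Koszul condition will be tested there. *)
Lemma max_below c : high c -> mdeg c = d -> (c < v)%O ->
  exists w, [/\ mdeg w = d, high w, (w < v)%O &
    forall c', mdeg c' = d -> high c' -> (w < c')%O -> (v <= c')%O].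
Proof.
pose below (w : 'X_{1..n.+1 < d.+1}) :=
  [&& mdeg w == d, [forall s : 'I_n.+1, (s <= o) ==> (w s == 0)]%N & (bmnm w < v)%O].
have belowP (w : 'X_{1..n.+1 < d.+1}) : reflect [/\ mdeg w = d, high w & (bmnm w < v)%O] (below w).
  apply: (iffP and3P) => -[].
    move=> /eqP dw /forallP w_low w_v; split=> // s so.
    by have /implyP/(_ so)/eqP := w_low s.
  by move=> -> w_low w_v; split=> //; apply/forallP=> s; apply/implyP=> /w_low->.
move=> c_high dc cv; have lt_c : (mdeg c < d.+1)%N by rewrite dc.
have below_c : below (BMultinom lt_c) by apply/belowP.
have [w /belowP[dw w_high wv] w_max] :=
  Order.TotalTheory.arg_maxP (fun x : 'X_{1..n.+1 < d.+1} => bmnm x) below_c.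
exists w; split=> // c' dc' c'_high wc'; rewrite leNgt; apply: contraL wc' => c'v.
have lt_c' : (mdeg c' < d.+1)%N by rewrite dc'.
by rewrite -leNgt; apply: (w_max (BMultinom lt_c')); apply/belowP.
Qed.

Lemma top_index m : (0 < mdeg m)%N ->
  exists2 r, (0 < m r)%N & forall s, (r < s)%N -> m s = 0%N.
Proof.
move=> m0; have [i0 _ m_i0] : exists2 i0, xpredT i0 & ((0%MM : 'X_{1..n.+1}) i0 < m i0)%N.
  by apply: mdeg_lt_ex; rewrite ?mdeg0.
rewrite mnm0E in m_i0.
case: (@arg_maxnP _ i0 (fun i => 0 < m i)%N (fun i => i : nat)) => // r m_r max_r.
exists r => // s; rewrite ltnNge => lt; apply/eqP; rewrite eqn0Ngt.
by apply: contra lt => /max_r.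
Qed.

Lemma bottom_index m : (0 < mdeg m)%N ->
  exists2 r, (0 < m r)%N & forall s, (s < r)%N -> m s = 0%N.
Proof.
move=> m0; have [i0 _ m_i0] : exists2 i0, xpredT i0 & ((0%MM : 'X_{1..n.+1}) i0 < m i0)%N.
  by apply: mdeg_lt_ex; rewrite ?mdeg0.
rewrite mnm0E in m_i0.
case: (@arg_minnP _ i0 (fun i => 0 < m i)%N (fun i => i : nat)) => // r m_r min_r.
exists r => // s; rewrite ltnNge => lt; apply/eqP; rewrite eqn0Ngt.
by apply: contra lt => /min_r.
Qed.

(* Dividing by the last variable is monotone for the lexicographic order. *)
Lemma le_move_top b w r : (mdeg b).+1 = d -> mdeg w = d -> high b -> high w ->
  ((b + U_(ord_max))%MM <= w)%O -> (0 < w r)%N -> (forall s, (r < s)%N -> w s = 0%N) ->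
  ((b + U_(o))%MM <= move o r w)%O.
Proof.
move=> db dw b_high w_high bw w_r r_top.
have or : (o < r)%N by rewrite ltnNge; apply: contraL w_r => /w_high->.
have dbo : mdeg (b + U_(o)) = d by rewrite mdegD mdeg1 addn1.
have dmv : mdeg (move o r w) = d by rewrite mdeg_move.
rewrite leNgt; apply: contraL bw => lt; rewrite -ltNge.
have [t eq_t lt_t] := lt_lexlt (etrans dmv (esym dbo)) lt.
have ro : r != o by rewrite neq_ltn or orbT.
have mv_o : move o r w o = 1%N by rewrite move_s 1?eq_sym // w_high.
have b_o : (b + U_(o))%MM o = 1%N by rewrite mnmDE b_high // mnm1E eqxx.
have ot : (o < t)%N.
  rewrite ltnNge leq_eqVlt; apply/negP=> /predU1P[/val_inj E|to].
    by rewrite E mv_o b_o in lt_t.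
  move: lt_t; rewrite mnmDE b_high ?mnm1E ?(ltnW to) //.
  by case: (o =P t) to => [->|//]; rewrite ltnn.
have bE s : (o < s)%N -> (b + U_(o))%MM s = b s.
  by move=> os; rewrite mnmDE mnm1E; case: (o =P s) os => [->|_]; rewrite ?ltnn ?addn0.
have wE s : (o < s)%N -> s != r -> move o r w s = w s.
  by move=> os sr; rewrite move_neq 1?eq_sym // neq_ltn os orbT.
(* A first difference from [x_r] on would be compensated after [x_r], where [w] has no variable. *)
have tr : (t < r)%N.
  rewrite ltnNge; apply/negP=> rt.
  have [i /andP[ti _] lt_i] : exists2 i : 'I_n.+1,
      (t < i)%N && (i != t) & ((b + U_(o))%MM i < move o r w i)%N.
    apply: mdeg_le_ex lt_t; last by rewrite dbo dmv.
    move=> i; rewrite -leqNgt leq_eqVlt => /predU1P[/val_inj->|it _]; first by rewrite eqxx.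
    by rewrite eq_t.
  have ri := leq_ltn_trans rt ti.
  by rewrite wE ?(ltn_trans or ri) ?r_top ?neq_ltn ?ri ?orbT in lt_i.
apply: lexlt_lt; first by rewrite dw mdegD mdeg1 addn1.
have tm : (t < @ord_max n)%N by apply: leq_trans tr (leq_ord r).
exists t => [i it|].
  rewrite mnmDE mnm1E; case: (ord_max =P i) it => [<-|_ it].
    by rewrite ltnNge (ltnW tm).
  have [io|oi] := leqP i o; first by rewrite w_high // b_high.
  by rewrite addn0 -bE // -eq_t // wE // neq_ltn (ltn_trans it tr).
rewrite mnmDE; apply: leq_trans (leq_addr _ _).
by rewrite -bE // -wE // neq_ltn tr.
Qed.

(* Otherwise the condition fails for [A = {o} + Q] at [w], where [Q] is the set of the [t]
   with [x_o w / x_t] in the segment. *)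
Lemma koszul_step w r : koszul_condition d L -> mdeg w = d -> high w -> (w < v)%O ->
  (forall c, mdeg c = d -> high c -> (w < c)%O -> (v <= c)%O) ->
  (0 < w r)%N -> (forall s, (r < s)%N -> w s = 0%N) ->
  (u < move o r w)%O -> forall t, (0 < w t)%N -> (u < move o t w)%O.
Proof.
move=> kos dw w_high wv w_max w_r r_top u_r t w_t; rewrite ltNge; apply/negP=> le_u.
have inL q : (0 < w q)%N -> (move o q w <= u)%O -> L (move o q w).
  move=> w_q le_q; have oq : (o < q)%N by rewrite ltnNge; apply: contraL w_q => /w_high->.
  have qo : o != q by rewrite neq_ltn oq.
  apply: between_o; rewrite ?mdeg_move ?move_s // => i io.
  by rewrite move_neq ?w_high // ?neq_ltn ?(ltn_trans io oq) ?io ?orbT // ltnW.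
pose Q := [set q | (0 < w q)%N && between (move o q w)].
have [||[l Ll lw]|[q [qQ w_q dq]]] := kos (o |: Q) w _ _ o (setU11 _ _).
- by rewrite dw.
- move=> a /setU1P[->|]; first by exists (move o t w); [exact: inL|exact: move_lem].
  (* For [a] in [Q], [x_a w / x_r] is larger than [w], hence at least [v] by the choice of [w]. *)
  rewrite inE => /andP[w_a La]; exists (move a r w); last exact: move_lem.
  have oa : (o < a)%N by rewrite ltnNge; apply: contraL w_a => /w_high->.
  have ar : (a < r)%N.
    rewrite ltnNge leq_eqVlt; apply/negP=> /predU1P[/val_inj E|/r_top E].
      by case/and3P: La => _; rewrite -E leNgt u_r.
    by rewrite E in w_a.
  have a_high : high (move a r w).
    by move=> i io; rewrite move_low ?w_high // (ltn_trans oa ar).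
  apply: between_no; rewrite ?mdeg_move // w_max ?mdeg_move //; exact: move_up_lt.
- have Lw : L w by rewrite -(lem_eq lw) // (between_deg Ll).
  by case/and3P: Lw => _ _; rewrite leNgt wv.
- move: qQ; rewrite in_setU1 negb_or inE w_q /= => /andP[_ /negP]; apply.
  by apply: divby_deg; rewrite ?mdeg_move.
Qed.


(** After [x_mu], [m'] involves only the last variable, and a power of it is the smallest monomial
    of its degree. *)
Lemma le_tail m m' mu : mdeg m = mdeg m' -> (mu < @ord_max n)%N ->
  (forall i, (i < mu)%N -> m' i = m i) -> (m' mu <= m mu)%N ->
  (forall i, (mu < i)%N -> (i < @ord_max n)%N -> m' i = 0%N) -> (m' <= m)%O.
Proof.
move=> dm mu_max eq_m le_mu m'0; rewrite leNgt; apply/negP=> lt.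
have [t eq_t lt_t] := lt_lexlt dm lt.
have mut : (mu < t)%N.
  rewrite ltnNge leq_eqVlt; apply/negP=> /predU1P[/val_inj E|/eq_m E].
    by move: lt_t; rewrite E ltnNge le_mu.
  by rewrite E ltnn in lt_t.
have [tm|mt] := ltnP t (@ord_max n); first by rewrite m'0 in lt_t.
have [i /andP[_ it] lt_i] : exists2 i, xpredT i && (i != t) & (m' i < m i)%N.
  by apply: mdeg_le_ex lt_t; rewrite ?dm.
have it' : (i < t)%N by rewrite ltn_neqAle it (leq_trans (leq_ord i) mt).
by rewrite eq_t // ltnn in lt_i.
Qed.

(* If no power of [x_mu] precedes [v], then [w = x_mu^d].  Otherwise, for the least [k] with
   [v <= x_mu^k x_n^(d-k)], the condition fails for [A = {o, mu}] at
   [x_mu^(k-1) x_n^(d-1-u_mu)]. *)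
Lemma koszul_bottom w : koszul_condition d L -> u o = 1%N -> mdeg w = d -> high w ->
  (w < v)%O -> (forall c, mdeg c = d -> high c -> (w < c)%O -> (v <= c)%O) ->
  (forall t, (0 < w t)%N -> (u < move o t w)%O) ->
  exists mu : 'I_n.+1,
    [/\ forall l s, L l -> l o = 1%N -> small o mu s -> l s = 0%N,
        forall l, L l -> l o = 0%N -> exists2 s, small o mu s & (0 < l s)%N &
        forall l s, mdeg l = d -> (forall i, (i <= o)%N -> l i = 0%N) ->
          small o mu s -> (0 < l s)%N -> L l].
Proof.
move=> kos u_o1 dw w_high wv w_max u_lt.
have d_gt0 : (0 < d)%N by rewrite -du mdegE (bigD1 o) //= addn_gt0 u_o.
have [|mu w_mu w_bot] := @bottom_index w; first by rewrite dw.
have omu : (o < mu)%N by rewrite ltnNge; apply: contraL w_mu => /w_high->.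
have muo : mu != o by rewrite neq_ltn omu orbT.
have dmv : mdeg (move o mu w) = d by rewrite mdeg_move.
(* From [u < x_o w / x_mu] it follows that [u] has no variable strictly between [x_o] and [x_mu],
   that [u mu < w mu], and that [x_mu] is not the last variable. *)
have [t eq_t lt_t] := lt_lexlt (etrans du (esym dmv)) (u_lt mu w_mu).
have mvE i : i != o -> i != mu -> move o mu w i = w i.
  by move=> io im; rewrite move_neq // eq_sym.
have mv_o : move o mu w o = 1%N by rewrite move_s ?w_high // eq_sym.
have mv_mu : move o mu w mu = (w mu).-1 by rewrite move_r // eq_sym.
have mut : (mu <= t)%N.
  rewrite leqNgt; apply/negP=> tmu; have [to|to] := eqVneq t o.
    by rewrite to u_o1 mv_o in lt_t.
  by rewrite mvE // ?w_bot // neq_ltn tmu in lt_t.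
have u_mid i : (o < i)%N -> (i < mu)%N -> u i = 0%N.
  by move=> oi im; rewrite eq_t ?(leq_trans im) // mvE ?w_bot // neq_ltn ?oi ?im ?orbT.
have u_mu : (u mu < w mu)%N.
  move: mut; rewrite leq_eqVlt => /predU1P[/val_inj E|mut].
    by move: lt_t; rewrite -E mv_mu; lia.
  by rewrite eq_t // mv_mu ltn_predL.
have mu_max : (mu < @ord_max n)%N.
  apply: leq_ltn_trans mut _; rewrite ltnNge; apply/negP=> maxt.
  have [i /andP[_ it] lt_i] : exists2 i, xpredT i && (i != t) & (move o mu w i < u i)%N.
    by apply: mdeg_le_ex lt_t; rewrite ?du ?dmv.
  have it' : (i < t)%N by rewrite ltn_neqAle it (leq_trans (leq_ord i) maxt).
  by rewrite eq_t // ltnn in lt_i.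
have omax := ltn_trans omu mu_max.
have /negbTE mux : mu != ord_max by rewrite neq_ltn mu_max.
(* [y k (d - k)] is the smallest monomial of degree [d] in the variables from [x_mu] on whose
   exponent at [x_mu] is at least [k]. *)
pose y k e : 'X_{1..n.+1} := (U_(mu) *+ k + U_(ord_max) *+ e)%MM.
have yE k e i : y k e i = ((mu == i) * k + (ord_max == i) * e)%N.
  by rewrite mnmDE !mulmnE !mnm1E.
have ydeg k e : mdeg (y k e) = (k + e)%N by rewrite mdegD !mdegMn !mdeg1 !mul1n.
have y_mu k e : y k e mu = k by rewrite yE eqxx eq_sym mux; lia.
have y_max k e : y k e ord_max = e by rewrite yE eqxx mux; lia.
have y_0 k e i : i != mu -> i != ord_max -> y k e i = 0%N.
  by move=> im imax; rewrite yE ![_ == i]eq_sym (negbTE im) (negbTE imax).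
have y_lt k e i : (i < mu)%N -> y k e i = 0%N.
  by move=> im; rewrite y_0 // neq_ltn ?im ?(ltn_trans im mu_max).
have y_high k e : high (y k e) by move=> i io; rewrite y_lt // (leq_ltn_trans io).
have w_mu_d : (w mu <= d)%N by rewrite -dw mdegE (bigD1 mu) //= leq_addr.
have y_le m k : mdeg m = d -> (forall i, (i < mu)%N -> m i = 0%N) -> (k <= m mu)%N ->
    (k <= d)%N -> (y k (d - k)%N <= m)%O.
  move=> dm m0 km kd; apply: (@le_tail _ _ mu) => //; first by rewrite dm ydeg subnKC.
  - by move=> i im; rewrite y_lt ?m0.
  - by rewrite y_mu.
  - by move=> i im imax; rewrite y_0 // neq_ltn ?im ?imax ?orbT.
have y_eq m : mdeg m = d -> (d <= m mu)%N -> m = y d 0%N.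
  move=> dm m_mu; apply/esym/lem_eq; last by rewrite dm ydeg addn0.
  apply/mnm_lepP=> i; rewrite yE muln0 addn0.
  by case: (mu =P i) => [<-|_]; rewrite ?mul1n.
have uE i : (i < mu)%N -> u i = (o == i).
  move=> im; have [io|oi|/val_inj->] := ltngtP i o; last by rewrite u_o1 eqxx.
    by rewrite u_low // eq_sym; case: eqP io => // ->; rewrite ltnn.
  by rewrite u_mid //; case: eqP oi => // ->; rewrite ltnn.
have [y_v|v_y] := ltP (y d 0%N) v.
  have w_mu_eq : w mu = d.
    apply/eqP; rewrite eqn_leq w_mu_d leqNgt; apply: contraL y_v => lt_mu.
    rewrite -leNgt; apply: w_max; rewrite ?ydeg ?addn0 //.
    apply: lexlt_lt; first by rewrite dw ydeg addn0.
    by exists mu => [i im|]; rewrite ?y_mu // y_lt // w_bot.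
  have Ew : w = y d 0%N by apply: y_eq; rewrite ?w_mu_eq.
  (* Members of degree 1 in [x_o] are at most [u], which has no small variable. Members free of
     [x_o] exceed [w = x_mu^d], so they involve a small variable. Conversely, any monomial after
     [x_o] with a small variable exceeds [w]. *)
  exists mu; split=> [l s Ll l_o /andP[os sm]|l Ll l_o|l s dl l_high /andP[os sm] l_s].
  - have [->|[t' eq_t' lt_t']] := le_lexlt Ll; first exact: u_mid.
    have [st'|t's] := ltnP s t'; first by rewrite eq_t' // u_mid.
    have t'm := leq_ltn_trans t's sm; rewrite uE // in lt_t'.
    by case: (o =P t') lt_t' => // <-; rewrite l_o.
  - have wl : (w < l)%O by case/and3P: Ll => _ _; apply: lt_le_trans.
    have [t' eq_t' lt_t'] := lt_lexlt (etrans dw (esym (between_deg Ll))) wl.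
    have [t'm|mt'] := ltnP t' mu.
      exists t'; last exact: leq_ltn_trans lt_t'.
      rewrite /small t'm andbT ltnNge; apply: contraL lt_t' => t'o.
      by rewrite (between_le_o Ll).
    have : (d <= l mu)%N.
      move: mt'; rewrite leq_eqVlt => /predU1P[/val_inj E|/eq_t' <-]; last by rewrite w_mu_eq.
      by move: lt_t'; rewrite -E w_mu_eq; apply: ltnW.
    by move/(y_eq _ (between_deg Ll)) => El; rewrite El -Ew ltxx in wl.
  - apply: between_no => //; apply: w_max => //; apply: lexlt_lt; first by rewrite dw.
    have [|r l_r r_bot] := @bottom_index l; first by rewrite dl.
    have rm : (r < mu)%N.
      by apply: leq_ltn_trans sm; rewrite leqNgt; apply: contraL l_s => /r_bot->.
    exists r => [i ir|]; last by rewrite w_bot.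
    by rewrite w_bot ?r_bot // (ltn_trans ir).
have exk : exists k, (k <= d)%N && (v <= y k (d - k)%N)%O by exists d; rewrite leqnn subnn.
case: (ex_minnP exk) => k /andP[kd v_yk] k_min.
(* Otherwise [k <= w mu], and [y k (d - k) <= w < v]. The bound makes the degree of the test
   monomial [y k.-1 e] at least [d]. *)
have lt_k : (u mu + 1 < k)%N.
  rewrite ltnNge; apply: contraL v_yk; rewrite -ltNge => k_le; apply: le_lt_trans wv.
  by apply: y_le => //; apply: leq_trans k_le _; rewrite addn1.
(* This exponent gives [x_o y (u mu) e] degree [d]; it is then at most [u], lies in the segment and
   divides [x_o y k.-1 e]. *)
pose e := (d - 1 - u mu)%N; have Ed : (u mu + e + 1 = d)%N by rewrite /e; lia.
(* A divisor of degree [d] has the form [y j (d - j)] with [j < k], which the minimality of [k]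
   keeps out of the segment. *)
have not_div l : L l -> (l <= y k.-1 e)%MM -> False.
  move=> Ll /mnm_lepP lm.
  have l_o : l o = 0%N by apply/eqP; rewrite -leqn0 -(y_high k.-1 e o) // lm.
  have El : l = y (l mu) (l ord_max).
    apply/mnmP=> i; have [->|im] := eqVneq i mu; first by rewrite y_mu.
    have [->|ix] := eqVneq i ord_max; first by rewrite y_max.
    by rewrite y_0 //; apply/eqP; rewrite -leqn0 -(y_0 k.-1 e i) // lm.
  have dl : (l mu + l ord_max = d)%N by rewrite -ydeg -El between_deg.
  have l_k : (l mu <= k.-1)%N by rewrite -[X in (_ <= X)%N](y_mu k.-1 e) lm.
  suff : (k <= l mu)%N by lia.
  apply: k_min; have -> : (d - l mu = l ord_max)%N by lia.
  by rewrite -El; case/and3P: Ll => _ _ ->; rewrite andbT; lia.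
have [||[l Ll lm]|[t' [t'A m_t' [l Ll lm]]]] := kos [set o; mu] (y k.-1 e) _ _ o (set21 _ _).
- by rewrite ydeg; lia.
- move=> a /set2P[]->.
    exists (y (u mu) e + U_(o))%MM; last first.
      apply/mnm_lepP=> i; rewrite mnmDE [X in (_ <= X)%N]mnmDE leq_add2r !yE leq_add2r leq_mul2l.
      by rewrite orbC; apply/orP; left; lia.
    have yo i : (i < mu)%N -> (y (u mu) e + U_(o))%MM i = (o == i).
      by move=> im; rewrite mnmDE mnm1E y_lt.
    have dy : mdeg (y (u mu) e + U_(o)) = d by rewrite mdegD mdeg1 ydeg.
    apply: between_o => //.
    + move=> i io; rewrite yo ?(ltn_trans io) //.
      by case: (o =P i) io => [->|//]; rewrite ltnn.
    + by rewrite yo // eqxx.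
    + apply: (@le_tail _ _ mu) => //; first by rewrite du dy.
      * by move=> i im; rewrite yo // uE.
      * by rewrite mnmDE y_mu mnm1E eq_sym (negbTE muo) addn0.
      * move=> i im ix; rewrite mnmDE y_0 ?neq_ltn ?im ?ix ?orbT // mnm1E.
        by case: (o =P i) im => [<-|//]; rewrite ltnNge (ltnW omu).
  exists (y k (d - k)%N); first by apply: between_no (y_high _ _) v_yk; rewrite ydeg subnKC.
  apply/mnm_lepP=> i; rewrite yE [X in (_ <= X)%N]mnmDE yE mnm1E.
  by case: (mu == i); case: (ord_max == i); rewrite ?mul1n ?mul0n; lia.
- by case: (not_div l).
have Et : t' = ord_max.
  apply/eqP; apply: contraLR m_t' => t'x; rewrite -eqn0Ngt y_0 //.
  by move: t'A; rewrite !inE negb_or => /andP[].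
subst t'; have xo : ord_max != o by rewrite neq_ltn omax orbT.
rewrite y_max in m_t'; move/mnm_lepP: lm => lm.
have l_o : (l o <= 1)%N by have := lm o; rewrite move_s 1?eq_sym // y_high.
have l_mu : (l mu <= k.-1)%N.
  by have := lm mu; rewrite move_neq ?y_mu 1?eq_sym // neq_ltn mu_max.
have l_x : (l ord_max <= e.-1)%N by have := lm ord_max; rewrite move_r ?y_max 1?eq_sym.
have El : l = (y (l mu) (l ord_max) + U_(o) *+ l o)%MM.
  apply/mnmP=> i; rewrite mnmDE mulmnE mnm1E.
  have [->|im] := eqVneq i mu; first by rewrite y_mu eq_sym (negbTE muo) addn0.
  have [->|ix] := eqVneq i ord_max; first by rewrite y_max eq_sym (negbTE xo) addn0.
  rewrite y_0 // add0n; case: (o =P i) => [<-|/eqP oi]; first by rewrite mul1n.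
  by apply/eqP; rewrite mul0n -leqn0; have := lm i; rewrite move_neq ?y_0 // eq_sym.
have dl : (l mu + l ord_max + l o = d)%N.
  by have := congr1 (@mdeg _) El; rewrite mdegD mdegMn mdeg1 mul1n ydeg (between_deg Ll).
have [l_o0|l_o1] := posnP (l o).
  case: (not_div l) => //; apply/mnm_lepP=> i; have := lm i.
  have [->|io] := eqVneq i o; first by rewrite l_o0.
  by rewrite moveE (eq_sym o) (negbTE io); lia.
(* The exponent of the last variable in [l] is at most [e - 1] and [l o = 1], so that of [x_mu] is
   at least [u mu + 1]. *)
have : (u < l)%O.
  apply: lexlt_lt; first by rewrite du (between_deg Ll).
  exists mu => [i im|]; last by lia.
  rewrite uE // [in RHS]El mnmDE y_lt // mulmnE mnm1E.
  have -> : l o = 1%N by lia.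
  by rewrite muln1.
by case/and3P: Ll => _; rewrite leNgt => /negP.
Qed.

(** If [u o = 1] and the hypothesis of [between_exch1] fails at [b], then [u < x_o b], while the
    product of [b] with the last variable is below [v], hence at most the largest [w] below [v].
    With [x_r] the last variable of [w], [le_move_top] gives [u < x_o w / x_r], where [koszul_step]
    and [koszul_bottom] start. *)
Lemma koszul_exch : koszul_condition d L ->
  (forall l t r, L l -> (o < t)%N -> (t < r)%N -> (0 < l r)%N ->
     (0 < l o)%N /\ L (move t o l) \/ L (move t r l)) \/
  u o = 1%N /\ exists mu : 'I_n.+1,
    [/\ forall l s, L l -> l o = 1%N -> small o mu s -> l s = 0%N,
        forall l, L l -> l o = 0%N -> exists2 s, small o mu s & (0 < l s)%N &
        forall l s, mdeg l = d -> (forall i, (i <= o)%N -> l i = 0%N) ->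
          small o mu s -> (0 < l s)%N -> L l].
Proof.
move=> kos; have [u_o2|u_o_le] := ltnP 1 (u o).
  by left=> l t r; apply: between_exch2.
have u_o1 : u o = 1%N by apply/eqP; rewrite eqn_leq u_o_le.
have o_max : (o < @ord_max n)%N.
  rewrite ltn_neqAle leq_ord andbT; apply: contraTneq u_o => E.
  suff : mdeg u = 0%N.
    by move/eqP; rewrite mdeg_eq0 => /eqP->; rewrite mnm0E.
  by rewrite du -dv mdegE big1 // => i _; rewrite v_low // E leq_ord.
pose bad (b : 'X_{1..n.+1 < d}) :=
  [&& (mdeg b).+1 == d, [forall s : 'I_n.+1, (s <= o) ==> (b s == 0)]%N,
  ~~ between (b + U_(o))%MM & ~~ between (b + U_(ord_max))%MM].
have [/existsP[b /and4P[/eqP db /forallP b_low' Nbo Nbm]]|/existsPn ok] :=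
  boolP [exists b, bad b]; last first.
  left=> l t r; apply: between_exch1 => // b db b_low.
  have lt_b : (mdeg b < d)%N by rewrite -db.
  have Eb : [forall s : 'I_n.+1, (s <= o) ==> (b s == 0)]%N.
    by apply/forallP=> s; apply/implyP=> /b_low->.
  have := ok (BMultinom lt_b); rewrite /bad /= db eqxx Eb /= negb_and !negbK.
  by case/orP; [left|right].
right; split=> //.
have {b_low'} b_high : high b by move=> s so; have := b_low' s; rewrite so => /eqP.
have u_b : (u < (b + U_(o))%MM)%O.
  rewrite ltNge; apply: contra Nbo => bu; apply: between_o => //.
  - by rewrite mdegD mdeg1 addn1.
  - move=> s so; rewrite mnmDE mnm1E (b_high _ (ltnW so)); case: (o =P s) => // E.
    by rewrite E ltnn in so.
  - by rewrite mnmDE mnm1E eqxx addn1.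
have bm_high : high (b + U_(ord_max))%MM.
  move=> s so; rewrite mnmDE mnm1E b_high //; case: (ord_max =P s) => // E.
  by rewrite -E leqNgt o_max in so.
have dbm : mdeg (b + U_(ord_max)) = d by rewrite mdegD mdeg1 addn1.
have b_v : ((b + U_(ord_max))%MM < v)%O.
  by rewrite ltNge; apply: contra Nbm => vb; apply: between_no.
have [w [dw w_high wv w_max]] := max_below bm_high dbm b_v.
have [|r w_r r_top] := @top_index w; first by rewrite dw -db.
have bw : ((b + U_(ord_max))%MM <= w)%O.
  by rewrite leNgt; apply: contraL b_v => wb; rewrite -leNgt w_max.
apply: (koszul_bottom kos u_o1 dw w_high wv w_max).
apply: (koszul_step kos dw w_high wv w_max w_r r_top).
by apply: lt_le_trans u_b (le_move_top db dw b_high w_high bw w_r r_top).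
Qed.

End Lexsegment.

(** * Orders on the generators of the powers *)

Section Orders.
Variable n : nat.
Implicit Types (g h l m : 'X_{1..n}) (s r t i o : 'I_n) (L : 'X_{1..n} -> Prop)
  (le : rel 'X_{1..n}).

Definition linear_order le := [/\ total le, transitive le & antisymmetric le].

Definition refine_order o le : rel 'X_{1..n} :=
  fun h g => (h o < g o)%N || (h o == g o) && le h g.

Lemma refine_order_linear o le : linear_order le -> linear_order (refine_order o le).
Proof.
move=> [le_tot le_tr le_anti]; rewrite /refine_order; split=> [g h|h g k|g h].
- by case: ltngtP => //= _; apply: le_tot.
- move=> /orP[lt1|/andP[/eqP-> R1]] /orP[lt2|/andP[/eqP<- R2]]; rewrite ?lt1 ?lt2 //.
    by rewrite (ltn_trans lt1).
  by rewrite eqxx (le_tr h) ?orbT.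
- by case: ltngtP => //= _; apply: le_anti.
Qed.

(** The combinatorial form of linear quotients: for [h] before [g], a variable [x_s] of
    [h / gcd(g, h)] is in the colon ideal at [g], through the earlier generator [x_s g / x_r]. *)
Definition exchange_order L le := forall g h, L g -> L h -> le h g -> h <> g ->
  exists s r, [/\ (g s < h s)%N, s != r, (0 < g r)%N, L (move s r g) & le (move s r g) g].

Definition translate (a : 'X_{1..n}) L m := exists2 m', L m' & m = (a + m')%MM.

Lemma mpow_translate a L N m :
  mpow (translate a L) N m <-> translate (a *+ N)%MM (mpow L N) m.
Proof.
elim: N m => [|N IH] m /=.
  rewrite mulm0n; split=> [->|[m' -> ->]]; last by rewrite addm0.
  by exists 0%MM; rewrite ?addm0.
split=> [[_ [_ [[x Lx ->] /IH[y Ly ->] ->]]]|[_ [x [y [Lx Ly ->]]] ->]].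
  exists (x + y)%MM; first by exists x, y.
  by apply/mnmP=> i; rewrite mulmS !mnmDE; lia.
exists (a + x)%MM, (a *+ N + y)%MM; split; [by exists x|by apply/IH; exists y|].
by apply/mnmP=> i; rewrite mulmS !mnmDE; lia.
Qed.

Lemma exchange_translate a L le : (forall g h, le (a + g)%MM (a + h)%MM = le g h) ->
  exchange_order L le -> exchange_order (translate a L) le.
Proof.
move=> le_add exch _ _ [g Lg ->] [h Lh ->]; rewrite le_add => hg neq.
have [|s [r [lt_s sr g_r Lmv lemv]]] := exch g h Lg Lh hg; first by move=> E; rewrite E in neq.
exists s, r; rewrite !mnmDE ltn_add2l addn_gt0 g_r orbT moveDr // le_add; split=> //.
by exists (move s r g).
Qed.

Lemma koszul_translate a L d : koszul_condition (mdeg a + d) (translate a L) ->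
  koszul_condition d L.
Proof.
move=> kos A m dm divA i iA.
have le_a m' l : (a + l <= a + m')%MM -> (l <= m')%MM.
  by move/mnm_lepP=> le; apply/mnm_lepP=> j; have := le j; rewrite !mnmDE leq_add2l.
have [||[_ [l Ll ->] /le_a lm]|[t [tA am_t [_ [l Ll ->] lm]]]] := kos A (a + m)%MM _ _ i iA.
- by rewrite mdegD leq_add2l.
- move=> j /divA[l Ll lm]; exists (a + l)%MM; first by exists l.
  by apply/mnm_lepP=> k; move/mnm_lepP/(_ k): lm; rewrite !mnmDE; lia.
- by left; exists l.
(* [x_t] divides [m] and not only [a], since [a] still divides [x_i a m / x_t]. *)
have ti : i != t by apply: contraNneq tA => <-.
have m_t : (0 < m t)%N.
  by move/mnm_lepP/(_ t): lm am_t; rewrite moveE !mnmDE (negbTE ti) eqxx; lia.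
right; exists t; split=> //; exists l => //.
by apply: le_a; rewrite -moveDr.
Qed.

End Orders.

(** * Removing the common factor of the members of a lexsegment *)

Section Reduction.
Variable n : nat.
Implicit Types (a g h l m u v : 'X_{1..n.+1}) (s r t i o : 'I_n.+1).

Lemma lexmE g h : mdeg g = mdeg h -> lexm g h = (g <= h)%O.
Proof. by move=> E; rewrite leEmnm /lexm E lexi_cons lexx. Qed.

(** The order is compatible with multiplication, so that it still serves once the common factor is
    restored. *)
Lemma reduced_order d o u v : (forall s, (s < o)%N -> u s = 0%N) ->
  (forall s, (s <= o)%N -> v s = 0%N) -> (0 < u o)%N -> mdeg u = d -> mdeg v = d ->
  koszul_condition d (between d u v) ->
  exists le, [/\ linear_order le, forall a g h, le (a + g)%MM (a + h)%MM = le g h &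
    forall N, exchange_order (mpow (between d u v) N) le].
Proof.
move=> u_low v_low u_o du dv /(koszul_exch u_low v_low u_o du dv) kos.
have low l s := @between_low _ _ _ _ v u_low du l s.
have deg l := @between_deg _ d u v l.
have down := between_down u_low v_low du dv.
case: kos => [exch|[u_o1 [mu [L_1 L_0 L_small]]]].
  exists (refine_order o (fun h g => g <= h)%O); split.
  - apply: refine_order_linear; split=> [g h|g h k hg gk|g h].
    + exact: le_total.
    + exact: le_trans gk hg.
    + by rewrite andbC => /le_anti.
  - by move=> a g h; rewrite /refine_order !mnmDE ltn_add2l eqn_add2l lemc_add2r.
  - move=> N g h Lg Lh hg neq.
    have dgh : mdeg g = mdeg h by rewrite (mdeg_mpow deg Lg) (mdeg_mpow deg Lh).
    have bef : before_up o h g.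
      case/orP: hg => [lt|/andP[/eqP E]]; first by left.
      rewrite le_eqVlt => /predU1P[E'|gh]; first by rewrite E' in neq.
      by right; split=> //; apply: lt_lexlt.
    have up l s t := @between_up _ _ _ _ v u_low u_o du l s t.
    have lower := between_lower u_low v_low u_o du dv.
    have [s [r [lt_s sr g_r Lmv bef']]] :=
      before_up_exch low deg up exch lower down Lg Lh bef.
    exists s, r; split=> //; case: bef' => [lt|[E lt]]; rewrite /refine_order ?lt //.
    by rewrite E ltnn eqxx ltW // lexlt_lt // mdeg_move.
exists (refine_order o (fun h g => h <= g)%O); split.
- apply: refine_order_linear; split=> [g h|g h k hg gk|g h].
  + exact: le_total.
  + exact: le_trans hg gk.
  + exact: le_anti.
- by move=> a g h; rewrite /refine_order !mnmDE ltn_add2l eqn_add2l lemc_add2r.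
- move=> N g h Lg Lh hg neq.
  have dgh : mdeg g = mdeg h by rewrite (mdeg_mpow deg Lg) (mdeg_mpow deg Lh).
  have bef : before_down o h g.
    case/orP: hg => [lt|/andP[/eqP E]]; first by left.
    rewrite le_eqVlt => /predU1P[E'|gh]; first by rewrite E' in neq.
    by right; split=> //; apply: lt_lexlt.
  have le1 l : between d u v l -> (l o <= 1)%N.
    by move=> /(between_le_u u_low du); rewrite u_o1.
  have [s [r [lt_s sr g_r Lmv bef']]] :=
    before_down_exch low deg le1 L_1 L_0 L_small down Lg Lh bef.
  exists s, r; split=> //; case: bef' => [lt|[E lt]]; rewrite /refine_order ?lt //.
  by rewrite E ltnn eqxx ltW // lexlt_lt // mdeg_move.
Qed.


Lemma between_translate a d u v m :
  between d u v m = between (mdeg a + d) (a + u)%MM (a + v)%MM (a + m)%MM.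
Proof. by rewrite /between mdegD eqn_add2l !lemc_add2r. Qed.

Lemma lexsegmentE u v w : mdeg u = mdeg v ->
  (w \in lexsegment u v) = between (mdeg u) u v w.
Proof.
move=> duv; rewrite unfold_in /= /lexsegment /between.
by case: eqP => //= dw; rewrite (lexmE dw) lexmE // dw duv.
Qed.

Lemma lexsegment_order u v : mdeg u = mdeg v -> lexm v u ->
  koszul_condition (mdeg u) (fun w => w \in lexsegment u v) ->
  exists le, linear_order le /\
    forall N, exchange_order (mpow (fun w => w \in lexsegment u v) N) le.
Proof.
move=> duv; rewrite lexmE // le_eqVlt => /predU1P[<-|vu kos].
  move=> _; exists (fun g h => g <= h)%O; split.
    by split; [exact: le_total|exact: le_trans|exact: le_anti].
  have uniq_v N g : mpow (fun w => w \in lexsegment v v) N g -> g = (v *+ N)%MM.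
    elim: N g => [|N IH] g /=; first by rewrite mulm0n.
    case=> a [b [+ /IH-> ->]]; rewrite mulmS lexsegmentE // => /and3P[_ av va].
    by congr (_ + _)%MM; apply/le_anti; rewrite av.
  by move=> N g h /uniq_v-> /uniq_v-> _ /(_ erefl).
have [o eq_o lt_o] := lt_lexlt (esym duv) vu.
(* [a] is the part of [v] up to [x_o], the first variable where [u] and [v] differ. It divides the
   whole segment; [v / a] involves only variables after [x_o], and [x_o] is the first variable of
   [u / a]. *)
pose a : 'X_{1..n.+1} := [multinom if (i <= o)%N then v i else 0%N | i < n.+1].
have av : (a <= v)%MM by apply/mnm_lepP=> i; rewrite mnmE; case: (i <= o)%N.
have au : (a <= u)%MM.
  apply/mnm_lepP=> i; rewrite mnmE; case: (leqP i o) => // io.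
  by move: io; rewrite [(i <= o)%N]leq_eqVlt => /predU1P[/val_inj->|/eq_o->] //; apply: ltnW.
have [Eu Ev] : u = (a + (u - a))%MM /\ v = (a + (v - a))%MM by rewrite ![(a + _)%MM]addmC !submK.
have du : mdeg u = (mdeg a + mdeg (u - a))%N by rewrite -mdegD -Eu.
have dva : mdeg (v - a) = mdeg (u - a).
  by apply/eqP; rewrite -(eqn_add2l (mdeg a)) -!mdegD -Eu -Ev duv.
have memE w : w \in lexsegment u v <->
    translate a (between (mdeg (u - a)) (u - a)%MM (v - a)%MM) w.
  rewrite lexsegmentE //; split; last first.
    by case=> m'; rewrite (between_translate a) -Eu -Ev -du => + ->.
  move=> bw; have aw : (a <= w)%MM.
    case/and3P: bw => /eqP dw wu vw; apply/mnm_lepP=> i; rewrite mnmE.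
    case: (leqP i o) => // io; move: vw; rewrite le_eqVlt => /predU1P[->//|vw].
    have [t2 eq2 lt2] := lt_lexlt (etrans (esym duv) (esym dw)) vw.
    have [it2|t2i] := ltnP i t2; first by rewrite eq2.
    move: t2i; rewrite [(t2 <= i)%N]leq_eqVlt => /predU1P[/val_inj<-|t2i]; first exact: ltnW.
    move: wu; rewrite le_eqVlt => /predU1P[->|wu].
      by move: io; rewrite [(i <= o)%N]leq_eqVlt => /predU1P[/val_inj->|/eq_o->];
        rewrite ?(ltnW lt_o).
    (* Before [x_o], [u] and [v] agree, so a first difference of [v < w] at [t2 < o] is incompatible
       with [w < u]. *)
    have [t1 eq1 lt1] := lt_lexlt dw wu.
    have t2o := leq_trans t2i io; case: (ltngtP t1 t2) => [t12|t21|/val_inj E].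
    - by move: lt1; rewrite -eq2 // eq_o ?ltnn // (ltn_trans t12).
    - by move: lt2; rewrite eq1 // -eq_o // ltnn.
    - by move: lt1; rewrite E -eq_o // ltnNge (ltnW lt2).
  by exists (w - a)%MM; rewrite ?[(a + _)%MM]addmC ?submK // (between_translate a) -Eu -Ev -du
    addmC submK.
have ua_low s : (s < o)%N -> (u - a)%MM s = 0%N.
  by move=> so; rewrite mnmBE mnmE (ltnW so) eq_o // subnn.
have va_low s : (s <= o)%N -> (v - a)%MM s = 0%N.
  by move=> so; rewrite mnmBE mnmE so subnn.
have ua_o : (0 < (u - a)%MM o)%N by rewrite mnmBE mnmE leqnn subn_gt0.
pose B := between (mdeg (u - a)) (u - a)%MM (v - a)%MM.
have transfer L L' k : (forall w, L w <-> L' w) -> koszul_condition k L -> koszul_condition k L'.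
  move=> LL' kosL A m dm divA i iA.
  have divLL' w : divby L w <-> divby L' w by split=> -[l /LL' Ll lw]; exists l.
  have [|/divLL'|[t [tA m_t /divLL' divt]]] := kosL A m dm _ i iA; [|by left|].
    by move=> j /divA/divLL'.
  by right; exists t.
have [|le [le_lin le_add exch]] := reduced_order ua_low va_low ua_o erefl dva.
  by apply: (@koszul_translate _ a); rewrite -du; apply: transfer kos.
exists le; split=> // N.
have powE m : mpow (fun w => w \in lexsegment u v) N m <-> translate (a *+ N)%MM (mpow B N) m.
  rewrite -mpow_translate; split; apply: mpow_sub => l; by move/memE.
move=> g h /powE Lg /powE Lh hg neq.
have [s [r [? ? ? Lmv ?]]] := exchange_translate (fun g h => le_add _ g h) (exch N) Lg Lh hg neq.
by exists s, r; split=> //; apply/powE.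
Qed.

End Reduction.

(** * Monomial ideals *)

Section Ideals.
Local Open Scope ring_scope.
Variable R : comNzRingType.
Implicit Types (G I J : R -> Prop) (p q : R).

Definition is_ideal J := [/\ J 0, forall p q, J p -> J q -> J (p + q) &
  forall p q, J q -> J (p * q)].

Lemma ideal_sum J k (f : 'I_k -> R) : is_ideal J -> (forall i, J (f i)) -> J (\sum_(i < k) f i).
Proof. by move=> [J0 JD _] Jf; apply: (big_ind J) => // i _. Qed.

Lemma ideal_gen_min G J p : is_ideal J -> (forall g, G g -> J g) -> ideal_gen G p -> J p.
Proof.
move=> idJ GJ [k [c [g [Gg ->]]]]; apply: ideal_sum => // i.
by case: idJ => _ _; apply; apply: GJ.
Qed.

Lemma ideal_gen_in G p : G p -> ideal_gen G p.
Proof. by move=> Gp; exists 1, (fun=> 1), (fun=> p); split=> //; rewrite big_ord1 mul1r. Qed.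

Lemma ideal_gen_ideal G : is_ideal (ideal_gen G).
Proof.
split.
- by exists 0%N, (fun=> 0), (fun=> 0); split; [case|rewrite big_ord0].
- move=> _ _ [k [c [g [Gg ->]]]] [k' [c' [g' [Gg' ->]]]].
  pose glue (f : 'I_k -> R) (f' : 'I_k' -> R) i :=
    match split i with inl i => f i | inr i => f' i end.
  exists (k + k')%N, (glue c c'), (glue g g'); split.
    by move=> i; rewrite /glue; case: split.
  rewrite big_split_ord /glue; congr (_ + _); apply: eq_bigr => i _.
    by rewrite (unsplitK (inl i)).
  by rewrite (unsplitK (inr i)).
- move=> p _ [k [c [g [Gg ->]]]]; exists k, (fun i => p * c i), g; split=> //.
  by rewrite mulr_sumr; apply: eq_bigr => i _; rewrite mulrA.
Qed.

Lemma ideal_gen_sub G G' p : (forall g, G g -> G' g) -> ideal_gen G p -> ideal_gen G' p.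
Proof.
move=> GG'; apply: ideal_gen_min => [|g /GG' G'g]; [exact: ideal_gen_ideal|exact: ideal_gen_in].
Qed.

End Ideals.

Section MonomialIdeals.
Local Open Scope ring_scope.
Variables (K : fieldType) (n : nat).
Implicit Types (p q : {mpoly K[n]}) (m w : 'X_{1..n}) (A : 'X_{1..n} -> Prop)
  (J : {mpoly K[n]} -> Prop).

Lemma supported_ideal (D : 'X_{1..n} -> Prop) :
  (forall m m', D m -> D (m' + m)%MM) ->
  is_ideal (fun p => forall m, m \in msupp p -> D m).
Proof.
move=> D_up; split=> [m|p q Dp Dq m /msuppD_le|p q Dq m /msuppM_le].
- by rewrite msupp0.
- by rewrite mem_cat => /orP[/Dp|/Dq].
- by case/allpairsP=> -[m1 m2] [/= _ /Dq Dm2 ->]; apply: D_up.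
Qed.

Lemma divby_add A m m' : divby A m -> divby A (m' + m)%MM.
Proof. by case=> l Al lm; exists l => //; apply: lepm_trans lm _; rewrite lem_addl. Qed.

Lemma divby_refl A m : A m -> divby A m.
Proof. by move=> Am; exists m => //; apply: lepm_refl. Qed.

Lemma monomial_genP A p :
  monomial_gen K A p <-> forall m, m \in msupp p -> divby A m.
Proof.
split.
  apply: (ideal_gen_min (J := fun p => forall m, m \in msupp p -> divby A m)).
    by apply: supported_ideal => m m'; apply: divby_add.
  by move=> _ [w Aw ->] m; rewrite msuppX inE => /eqP->; apply: divby_refl.
move=> divp; rewrite [p]mpolyE big_seq.
have idA : is_ideal (monomial_gen K A) by apply: ideal_gen_ideal.
case: (idA) => A0 AD AM; apply: (big_ind (monomial_gen K A)) => // m /divp[w Aw wm].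
rewrite -mul_mpolyC -(submK wm) mpolyXD mulrA; apply: AM.
by apply: ideal_gen_in; exists w.
Qed.

Lemma monomial_genX A m : monomial_gen K A 'X_[m] <-> divby A m.
Proof.
split=> [/monomial_genP|Am]; first by apply; rewrite msuppX inE.
by apply/monomial_genP=> m'; rewrite msuppX inE => /eqP->.
Qed.

Lemma ideal_pow_monomial A N p :
  ideal_pow (monomial_gen K A) N p <-> monomial_gen K (mpow A N) p.
Proof.
elim: N p => [|N IH] p; first split=> // _.
  by apply/monomial_genP=> m _; exists 0%MM => //; apply/mnm_lepP=> i; rewrite mnm0E.
split; last first.
  apply: ideal_gen_sub => _ [w [a [b [Aa Ab ->]]] ->]; exists 'X_[a], 'X_[b]; rewrite mpolyXD.
  split; first by apply: ideal_gen_in; exists a.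
  by split=> //; apply/IH; apply: ideal_gen_in; exists b.
apply: ideal_gen_min; first exact: ideal_gen_ideal.
move=> _ [a [b [/monomial_genP Aa [/IH/monomial_genP Ab ->]]]].
apply/monomial_genP=> m /msuppM_le/allpairsP[[m1 m2] [/= /Aa[x Ax xm1] /Ab[y Ay ym2] ->]].
exists (x + y)%MM; first by exists x, y.
by apply/mnm_lepP=> i; rewrite !mnmDE leq_add //; apply/mnm_lepP.
Qed.

Lemma mdeg_le m m' : (m <= m')%MM -> (mdeg m <= mdeg m')%N.
Proof. by move=> mm'; rewrite -(submK mm') mdegD leq_addl. Qed.

(** All members of [A] have the same degree, so none properly divides another. *)
Lemma min_monomial_genE J A d : (forall p, J p <-> monomial_gen K A p) ->
  (forall w, A w -> mdeg w = d) -> forall m, min_monomial_gen J m <-> A m.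
Proof.
move=> JA Ad m; split.
  move=> [/JA/monomial_genX[w Aw wm] min_m]; suff <- : w = m by [].
  by apply: min_m => //; apply/JA/monomial_genX/divby_refl.
move=> Am; split; first by apply/JA/monomial_genX/divby_refl.
move=> m' /JA/monomial_genX[w Aw wm'] m'm.
have Ewm : w = m by apply: lem_eq (lepm_trans wm' m'm) _; rewrite !Ad.
apply: lem_eq => //; apply/eqP; rewrite eqn_leq mdeg_le //=.
by rewrite -Ewm mdeg_le.
Qed.

(** The generators are sorted by [le]. The colon ideal at [g] is generated by the [x_j] such that an
    earlier generator divides [x_j g]: if an earlier [h] divides [g m], the exchange yields such a
    variable, and it divides [m]. *)
Lemma linear_quotients_order J A d le (s : seq 'X_{1..n}) :
  (forall p, J p <-> monomial_gen K A p) -> (forall w, A w -> mdeg w = d) ->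
  (forall m, m \in s <-> A m) -> linear_order le -> exchange_order A le ->
  linear_quotients J.
Proof.
move=> JA Ad sA [le_tot le_tr le_anti] exch; split; first by exists A.
pose t := sort le (undup s).
have tA m : m \in t <-> A m by rewrite mem_sort mem_undup.
have t_uniq : uniq t by rewrite sort_uniq undup_uniq.
have t_sorted : sorted le t by apply: sort_sorted.
have le_refl : reflexive le by move=> m; have := le_tot m m; rewrite orbb.
exists t; split=> // [m|i /andP[_ it]].
  by rewrite (min_monomial_genE JA Ad) tA.
set g := nth _ _ _; have tg : g \in t by apply: mem_nth.
have Ag : A g by apply/tA.
have beforeE h : h \in take i t <-> [/\ A h, le h g & h <> g].
  rewrite in_take_leq; last exact: ltnW.
  have gi : index g t = i by rewrite index_uniq.
  split=> [hi|[/tA ht hg neq]].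
    have ht : h \in t by rewrite -index_mem (ltn_trans hi).
    split; first exact/tA.
      rewrite -[h](nth_index 0%MM ht) /g.
      by apply: (sorted_leq_nth le_tr le_refl) => //; [rewrite inE index_mem|exact: ltnW].
    by move=> E; rewrite E gi ltnn in hi.
  rewrite ltnNge; apply/negP=> ih; apply: neq; apply: le_anti; rewrite hg /=.
  rewrite -[X in le _ X](nth_index 0%MM ht) /g.
  by apply: (sorted_leq_nth le_tr le_refl); rewrite // inE index_mem.
pose B := [set j | has (fun h => (h <= g + U_(j))%MM) (take i t)]; exists B => p.
have colE : colon (monomial_gen K (fun m => m \in take i t)) 'X_[g] p <->
    forall m, m \in msupp p -> divby (fun m => m \in take i t) (g + m)%MM.
  rewrite /colon; split=> [/monomial_genP H m mp|H].
    by apply: H; rewrite (perm_mem (msuppMX p g)) map_f.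
  by apply/monomial_genP=> m; rewrite (perm_mem (msuppMX p g)) => /mapP[m' /H + ->].
rewrite colE; split=> [H|H m mp].
  suff : monomial_gen K (fun m => exists2 j, j \in B & m = U_(j)%MM) p.
    by apply: ideal_gen_sub => _ [m [j jA ->] ->]; exists j.
  apply/monomial_genP=> m /H[h hi hm].
  have [Ah hg neq] := (beforeE h).1 hi.
  have [a [r [lt_a ar g_r Amv lemv]]] := exch g h Ag Ah hg neq.
  exists U_(a)%MM.
    exists a => //; rewrite inE; apply/hasP; exists (move a r g); last exact: move_lem.
    by apply/beforeE; split=> // E; have := move_s g ar; rewrite E; lia.
  by rewrite lep1mP -lt0n; move/mnm_lepP/(_ a): hm; rewrite mnmDE; lia.
have : monomial_gen K (fun m => exists2 j, j \in B & m = U_(j)%MM) p.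
  by apply: ideal_gen_sub H => _ [j jA ->]; exists U_(j)%MM => //; exists j.
move=> /monomial_genP/(_ m mp)[_ [j jA ->] jm].
move: jA; rewrite inE => /hasP[h hi hj]; exists h => //; apply: lepm_trans hj _.
by apply/mnm_lepP=> k; rewrite !mnmDE leq_add2l; apply/mnm_lepP.
Qed.

Lemma mpow_enum A N : (exists s : seq 'X_{1..n}, forall m, m \in s <-> A m) ->
  exists s : seq 'X_{1..n}, forall m, m \in s <-> mpow A N m.
Proof.
case=> s sA; elim: N => [|N [t tA]].
  by exists [:: 0%MM] => m; rewrite inE; split=> /eqP.
exists [seq (a + b)%MM | a <- s, b <- t] => m; split.
  by case/allpairsP=> -[a b] [/= /sA Aa /tA Ab ->]; exists a, b.
by case=> a [b [/sA Aa /tA Ab ->]]; apply/allpairsP; exists (a, b).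
Qed.

End MonomialIdeals.

(** * Linear quotients imply a linear resolution *)

Section LinearQuotientModules.
Local Open Scope ring_scope.
Variables (K : fieldType) (n : nat).
Local Notation S := {mpoly K[n]}.
Implicit Types (p q : S) (A : {set 'I_n}).

Definition in_vars A p := forall m, m \in msupp p -> exists2 j, j \in A & (0 < m j)%N.

Lemma in_varsP A p :
  in_vars A p <-> ideal_gen (fun q => exists2 j, j \in A & q = 'X_j) p.
Proof.
have E : monomial_gen K (fun m => exists2 j, j \in A & m = U_(j)%MM) p <->
    ideal_gen (fun q => exists2 j, j \in A & q = 'X_j) p.
  split; apply: ideal_gen_sub => g; first by case=> m [j jA ->] ->; exists j.
  by case=> j jA ->; exists U_(j)%MM => //; exists j.
rewrite -E monomial_genP; split=> H m /H.
  by case=> j jA jm; exists U_(j)%MM; [exists j|rewrite lep1mP -lt0n].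
by case=> _ [j jA ->]; rewrite lep1mP -lt0n; exists j.
Qed.

Lemma in_vars_ideal A : is_ideal (in_vars A).
Proof.
apply: supported_ideal => m m' [j jA jm]; exists j => //.
by rewrite mnmDE addn_gt0 jm orbT.
Qed.

Lemma mulX_in_vars A j p : in_vars A (p * 'X_j) -> j \notin A -> in_vars A p.
Proof.
move=> H jA m mp; have [|k kA] := H (U_(j) + m)%MM.
  by rewrite (perm_mem (msuppMX p U_(j))) map_f.
rewrite mnmDE mnm1E; case: (j =P k) => [E|_] mk; last by exists k.
by rewrite E kA in jA.
Qed.

Definition in_span r s (Z : 'M[S]_(r, s)) (b : nat) (x : 'rV[S]_s) :=
  exists2 y : 'rV[S]_r, (forall l : 'I_r, (b <= l)%N -> y 0 l = 0) & x = y *m Z.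

Lemma in_span0 r s (Z : 'M[S]_(r, s)) b : in_span Z b 0.
Proof. by exists 0 => [l _|]; rewrite ?mxE ?mul0mx. Qed.

Lemma in_spanD r s (Z : 'M[S]_(r, s)) b x x' :
  in_span Z b x -> in_span Z b x' -> in_span Z b (x + x').
Proof.
move=> [y y0 ->] [y' y'0 ->]; exists (y + y'); rewrite ?mulmxDl // => l bl.
by rewrite mxE y0 // y'0 // addr0.
Qed.

Lemma in_spanZ r s (Z : 'M[S]_(r, s)) b p x : in_span Z b x -> in_span Z b (p *: x).
Proof.
move=> [y y0 ->]; exists (p *: y); rewrite ?scalemxAl // => l bl.
by rewrite mxE y0 // mulr0.
Qed.

Lemma in_span_row r s (Z : 'M[S]_(r, s)) b (k : 'I_r) : (k < b)%N -> in_span Z b (row k Z).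
Proof.
move=> kb; exists (delta_mx 0 k); last exact: rowE.
by move=> l bl; rewrite mxE eqxx /=; case: eqP bl => // ->; rewrite leqNgt kb.
Qed.

(* The colon of the span of the rows before [k] by row [k] is generated by variables. *)
Definition module_quotients r s (Z : 'M[S]_(r, s)) (A : 'I_r -> {set 'I_n}) :=
  forall (k : 'I_r) p, in_span Z k (p *: row k Z) <-> in_vars (A k) p.

Lemma pihomogMr dx dz p q : q \is dz.-homog ->
  pihomog mdeg (dx + dz)%N (p * q) = pihomog mdeg dx p * q.
Proof.
move=> qh; rewrite [p in LHS]mpolyE [p in RHS]mpolyE mulr_suml !linear_sum /= mulr_suml.
apply: eq_bigr => m _; rewrite -scalerAl !linearZ /= pihomogX -scalerAl; congr (_ *: _).
have mqh : 'X_[m] * q \is (mdeg m + dz).-homog by apply: dhomogM; rewrite // dhomogX.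
case: eqP => [<-|/eqP ne]; first exact: pihomog_dE.
by rewrite mul0r; apply: pihomog_ne0 mqh; rewrite eqn_add2r.
Qed.

(** A combination with homogeneous value may be taken with homogeneous coefficients, by extracting
    the component of the right degree. *)
Lemma pihomog_mulmx r s (Z : 'M[S]_(r, s)) (x : 'rV[S]_r) dx dz :
  (forall k t, Z k t \is dz.-homog) -> (forall t, (x *m Z) 0 t \is (dx + dz).-homog) ->
  x *m Z = (\row_k pihomog mdeg dx (x 0 k)) *m Z.
Proof.
move=> Zh xh; apply/rowP=> t; rewrite -(pihomog_dE (xh t)) !mxE linear_sum.
by apply: eq_bigr => k _; rewrite mxE /= pihomogMr.
Qed.

(** One step of the resolution: generators of a module of syzygies, as rows with entries of a common
    degree, together with their linear quotients. *)
Record stage (s : nat) := Stage {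
  stage_rk : nat;
  stage_mx : 'M[S]_(stage_rk, s);
  stage_vars : 'I_stage_rk -> {set 'I_n};
  stage_deg : nat;
  stage_homog : forall k t, stage_mx k t \is stage_deg.-homog;
  stage_quotients : module_quotients stage_mx stage_vars
}.

(** * Syzygies of a module with linear quotients *)

Section Syzygies.
Variables (r s : nat) (Z : 'M[S]_(r, s)) (A : 'I_r -> {set 'I_n}) (dz : nat).
Hypothesis Z_homog : forall k t, Z k t \is dz.-homog.
Hypothesis Z_quot : module_quotients Z A.

(** [x_j] times row [k] is a combination of the earlier rows with linear coefficients. The condition
    is boolean so that [xchoose] can pick one. *)
Definition is_relation (k : 'I_r) (j : 'I_n) (c : 'rV[S]_r) :=
  [&& [forall l : 'I_r, (k <= l)%N ==> (c 0 l == 0)], [forall l, c 0 l \is 1.-homog] &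
      'X_j *: row k Z == c *m Z].

Lemma ex_relation (x : 'I_r * 'I_n) : exists c, (x.2 \in A x.1) ==> is_relation x.1 x.2 c.
Proof.
case: x => k j /=; have [jA|_] := boolP (j \in A k); last by exists 0.
have [|y y0 Ey] := (Z_quot k 'X_j).2.
  by move=> m; rewrite msuppX inE => /eqP->; exists j; rewrite // mnm1E eqxx.
exists (\row_l pihomog mdeg 1 (y 0 l)); rewrite /is_relation /=; apply/and3P; split.
- by apply/forallP=> l; apply/implyP=> kl; rewrite mxE y0 // pihomog0.
- by apply/forallP=> l; rewrite mxE pihomogP.
rewrite Ey; apply/eqP/pihomog_mulmx => // t; rewrite -Ey !mxE.
by apply: dhomogM; rewrite // dhomogX /= mdeg1.
Qed.

Definition relation x := xchoose (ex_relation x).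

Lemma relationP k j : j \in A k -> [/\ forall l : 'I_r, (k <= l)%N -> relation (k, j) 0 l = 0,
  forall l, relation (k, j) 0 l \is 1.-homog & 'X_j *: row k Z = relation (k, j) *m Z].
Proof.
move=> jA; have /implyP/(_ jA)/and3P[/forallP H1 /forallP H2 /eqP H3] :=
  xchooseP (ex_relation (k, j)).
by split=> // l kl; have := H1 l; rewrite kl => /eqP.
Qed.

(** A numerical encoding of the lexicographic order on pairs. *)
Definition pair_key (x : 'I_r * 'I_n) := (x.1 * n + x.2)%N.

Lemma pair_keyE (x y : 'I_r * 'I_n) : (pair_key x < pair_key y)%N ->
  (x.1 < y.1)%N || (x.1 == y.1) && (x.2 < y.2)%N.
Proof.
case: x y => [k j] [k' j']; rewrite /pair_key /= => lt.
have := ltn_ord j; have := ltn_ord j'; case: (ltngtP k k') => //=; last first.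
  by move=> /val_inj E; subst k'; rewrite eqxx /=; lia.
move=> kk' j'n jn; have : (k'.+1 * n <= k * n)%N by rewrite leq_mul2r kk' orbT.
by rewrite mulSn; lia.
Qed.

Lemma pair_key_lt1 (x y : 'I_r * 'I_n) : (x.1 < y.1)%N -> (pair_key x < pair_key y)%N.
Proof.
case: x y => [k j] [k' j']; rewrite /pair_key /= => kk'; have := ltn_ord j.
by have : (k.+1 * n <= k' * n)%N; [rewrite leq_mul2r kk' orbT|rewrite mulSn; lia].
Qed.

Definition pairs := sort (fun x y => pair_key x <= pair_key y)%N
  [seq x <- enum {: 'I_r * 'I_n} | x.2 \in A x.1].

Definition pair_of (a : 'I_(size pairs)) := tnth (in_tuple pairs) a.

Implicit Types a : 'I_(size pairs).

Lemma pair_ofP a : (pair_of a).2 \in A (pair_of a).1.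
Proof. by have := mem_tnth a (in_tuple pairs); rewrite mem_sort mem_filter => /andP[]. Qed.

Lemma ex_pair_of k j : j \in A k -> exists a, pair_of a = (k, j).
Proof.
move=> jA; have : (k, j) \in in_tuple pairs by rewrite mem_sort mem_filter /= jA mem_enum.
by case/tnthP=> a ->; exists a.
Qed.

Lemma pair_key_inj : injective pair_key.
Proof.
move=> [k j] [k' j']; rewrite /pair_key /= => E; have := ltn_ord j => jn; have := ltn_ord j' => j'n.
have kk : k = k'.
  apply/val_inj => /=; have := congr1 (fun m => m %/ n)%N E.
  by rewrite !divnMDl ?(leq_ltn_trans _ jn) // !divn_small // !addn0.
by subst k'; congr (_, _); apply/val_inj/(addnI E).
Qed.

Lemma pair_of_lt a (b : 'I_(size pairs)) :
  (a < b)%N = (pair_key (pair_of a) < pair_key (pair_of b))%N.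
Proof.
have uniq_pairs : uniq pairs by rewrite sort_uniq filter_uniq ?enum_uniq.
have sorted_pairs : sorted (fun x y => pair_key x <= pair_key y)%N pairs.
  by apply: sort_sorted => x y; apply: leq_total.
have mono (c e : 'I_(size pairs)) : (c <= e)%N -> (pair_key (pair_of c) <= pair_key (pair_of e))%N.
  move=> ce; have x0 := pair_of c; rewrite /pair_of !(tnth_nth x0).
  apply: (sorted_leq_nth _ _ x0 sorted_pairs); rewrite ?inE ?ltn_ord //.
  by move=> ? ? ?; apply: leq_trans.
apply/idP/idP=> [ab|]; last by rewrite !ltnNge; apply: contra; apply: mono.
rewrite ltn_neqAle mono ?(ltnW ab) // andbT; apply: contraTneq ab => /pair_key_inj E.
have x0 := pair_of a; move/eqP: E; rewrite /pair_of !(tnth_nth x0).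
by rewrite nth_uniq ?ltn_ord // => /eqP->; rewrite ltnn.
Qed.

(** The row of the pair [(k, j)] is [x_j e_k - relation (k, j)]; its last nonzero entry is [x_j], at
    [k]. *)
Definition syzygy_mx : 'M[S]_(size pairs, r) :=
  \matrix_(a, l) (((pair_of a).1 == l)%:R * 'X_((pair_of a).2) - relation (pair_of a) 0 l).

Lemma syzygyE a : row a syzygy_mx =
  'X_((pair_of a).2) *: delta_mx 0 (pair_of a).1 - relation (pair_of a).
Proof.
by apply/rowP=> l; rewrite !mxE eqxx /= eq_sym mulrC.
Qed.

Lemma syzygy_homog a l : syzygy_mx a l \is 1.-homog.
Proof.
have := pair_ofP a; rewrite mxE; case: (pair_of a) => k j /= /relationP[_ rh _].
apply: rpredB (rh l); case: (k == l); last by rewrite mul0r rpred0.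
by rewrite mul1r dhomogX /= mdeg1.
Qed.

Lemma syzygy_ker : syzygy_mx *m Z = 0.
Proof.
apply/row_matrixP=> a; rewrite row_mul row0 syzygyE.
have := pair_ofP a; case: (pair_of a) => k j /= /relationP[_ _ E].
by rewrite mulmxBl -scalemxAl -rowE E subrr.
Qed.

Lemma syzygy_high a (l : 'I_r) : ((pair_of a).1 < l)%N -> syzygy_mx a l = 0.
Proof.
have := pair_ofP a; rewrite mxE; case: (pair_of a) => k j /= /relationP[r0 _ _] kl.
by rewrite r0 1?ltnW // subr0; case: eqP kl => [->|]; rewrite ?ltnn ?mul0r.
Qed.

Lemma syzygy_diag a : syzygy_mx a (pair_of a).1 = 'X_((pair_of a).2).
Proof.
have := pair_ofP a; rewrite mxE; case: (pair_of a) => k j /= /relationP[r0 _ _].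
by rewrite r0 // subr0 eqxx mul1r.
Qed.

Lemma vars_ind (P : S -> Prop) (B : {set 'I_n}) p : is_ideal P ->
  (forall j, j \in B -> P 'X_j) -> in_vars B p -> P p.
Proof.
move=> idP PX /in_varsP; apply: ideal_gen_min => // _ [j jB ->]; exact: PX.
Qed.

Definition leading (k : 'I_r) p := exists y : 'rV[S]_(size pairs),
  [/\ forall a, (k < (pair_of a).1)%N -> y 0 a = 0, (y *m syzygy_mx) 0 k = p &
      forall l : 'I_r, (k < l)%N -> (y *m syzygy_mx) 0 l = 0].

(** The leading coefficients at [e_k] form an ideal, which contains [x_j] because of the syzygy of
    [(k, j)]. *)
Lemma leading_syzygy (k : 'I_r) p : in_vars (A k) p -> leading k p.
Proof.
apply: (vars_ind (P := leading k)); first split.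
- by exists 0; split=> [a _||l _]; rewrite ?mul0mx mxE.
- move=> p1 p2 [y1 [H1 H2 H3]] [y2 [G1 G2 G3]]; exists (y1 + y2).
  split=> [a ka||l kl]; rewrite ?mulmxDl mxE ?H1 ?G1 ?H2 ?G2 ?H3 ?G3 ?addr0 //.
- move=> p1 p2 [y [H1 H2 H3]]; exists (p1 *: y).
  by split=> [a ka||l kl]; rewrite -?scalemxAl mxE ?H1 ?H2 ?H3 ?mulr0.
move=> j jA; have [a Ea] := ex_pair_of jA; exists (delta_mx 0 a).
split=> [b kb||l kl]; rewrite -?rowE mxE.
- by rewrite eqxx /=; case: eqP kb => // ->; rewrite Ea ltnn.
- by have := syzygy_diag a; rewrite Ea.
- by rewrite syzygy_high // Ea.
Qed.

(* Successively cancels the last nonzero entry, which lies in [(x_j, j \in A k)]. *)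
Lemma ker_span (b : nat) (x : 'rV[S]_r) : (forall l : 'I_r, (b <= l)%N -> x 0 l = 0) ->
  x *m Z = 0 -> exists2 y : 'rV[S]_(size pairs),
    (forall a, (b <= (pair_of a).1)%N -> y 0 a = 0) & x = y *m syzygy_mx.
Proof.
elim: b x => [|b IH] x x0 xZ.
  exists 0 => [a _|]; rewrite ?mxE // mul0mx; apply/rowP=> l.
  by rewrite mxE x0.
have [br|rb] := ltnP b r; last first.
  have [|y y0 Ey] := IH x _ xZ; first by move=> l /(leq_trans rb); rewrite leqNgt ltn_ord.
  by exists y => // a /ltnW; apply: y0.
pose k := Ordinal br.
(* The relation [x *m Z = 0] puts the entry at [k] into the colon ideal of row [k]. *)
have /leading_syzygy[y [y0 yk yl]] : in_vars (A k) (x 0 k).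
  apply/Z_quot; exists (x 0 k *: delta_mx 0 k - x) => [l kl|]; last first.
    by rewrite mulmxBl xZ subr0 -scalemxAl -rowE.
  rewrite !mxE eqxx /=; case: (l =P k) => [->|lk]; first by rewrite mulr1 subrr.
  rewrite mulr0 x0 ?subr0 // ltn_neqAle kl andbT.
  by apply/eqP => E; apply/lk/val_inj.
have [l bl||y' y'0 Ey'] := IH (x - y *m syzygy_mx).
- rewrite mxE [in X in _ + X]mxE; move: bl; rewrite leq_eqVlt => /predU1P[E|bl].
    have -> : l = k by apply/val_inj.
    by rewrite yk subrr.
  by rewrite x0 // yl // subr0.
- by rewrite mulmxBl xZ -mulmxA syzygy_ker mulmx0 subr0.
exists (y' + y) => [a ba|]; last by rewrite mulmxDl -Ey' subrK.
by rewrite mxE y'0 1?ltnW // y0 ?addr0.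
Qed.

Definition syzygy_vars a := [set j in A (pair_of a).1 | (j < (pair_of a).2)%N].

(* For [j' < j] in [A k], the element [x_j' s_(k,j) - x_j s_(k,j')] is a relation among the
   rows before [k], hence is spanned by earlier syzygies. *)
Lemma syzygy_quotients : module_quotients syzygy_mx syzygy_vars.
Proof.
move=> a p; split; last first.
  apply: (vars_ind (P := fun p => in_span syzygy_mx a (p *: row a syzygy_mx))); first split.
  - by rewrite scale0r; apply: in_span0.
  - by move=> p1 p2 H1 H2; rewrite scalerDl; apply: in_spanD.
  - by move=> p1 p2 H; rewrite -scalerA; apply: in_spanZ.
  move=> j'; rewrite inE => /andP[j'A j'j].
  have [b Eb] := ex_pair_of j'A.
  have ba : (b < a)%N by rewrite pair_of_lt Eb /pair_key /= ltn_add2l.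
  have [y y0 Ey] : exists2 y : 'rV[S]_(size pairs),
      (forall c, ((pair_of a).1 <= (pair_of c).1)%N -> y 0 c = 0) &
      'X_j' *: row a syzygy_mx - 'X_((pair_of a).2) *: row b syzygy_mx = y *m syzygy_mx.
    apply: ker_span => [l|]; last first.
      by rewrite mulmxBl -!scalemxAl -!row_mul syzygy_ker !row0 !scaler0 subr0.
    have -> : ('X_j' *: row a syzygy_mx - 'X_((pair_of a).2) *: row b syzygy_mx) 0 l =
        'X_j' * syzygy_mx a l - 'X_((pair_of a).2) * syzygy_mx b l by rewrite !mxE.
    rewrite leq_eqVlt => /predU1P[/val_inj<-|al].
      by rewrite syzygy_diag; have := syzygy_diag b; rewrite Eb /= => ->; rewrite mulrC subrr.
    by rewrite !syzygy_high ?Eb // !mulr0 subrr.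
  move/(canRL (subrK _)): Ey => ->; apply: in_spanD; last exact/in_spanZ/in_span_row.
  exists y => // l al; apply: y0; rewrite leqNgt; apply: contraL al => lt1.
  by rewrite -ltnNge pair_of_lt pair_key_lt1.
(* In column [k], earlier rows with a smaller first index vanish, and the others contribute
   variables before [x_j]. So [p x_j] lies in the ideal of these variables, and [x_j] can be
   cancelled. *)
move=> [c c0 Ec]; have jj : (pair_of a).2 \notin syzygy_vars a by rewrite inE ltnn andbF.
apply: mulX_in_vars jj.
have -> : p * 'X_((pair_of a).2) = \sum_b c 0 b * syzygy_mx b (pair_of a).1.
  have := congr1 (fun x : 'rV[S]_r => x 0 (pair_of a).1) Ec.
  by rewrite mxE [X in _ * X]mxE syzygy_diag [RHS]mxE.
have idV := in_vars_ideal (syzygy_vars a).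
case: (idV) => v0 _ vM; apply: (ideal_sum idV) => b.
have [ab|ba] := leqP a b; first by rewrite c0 // mul0r.
apply: vM; move: ba; rewrite pair_of_lt => /pair_keyE /orP[lt1|/andP[/eqP E1 lt2]].
  by rewrite syzygy_high.
rewrite -E1 syzygy_diag => m; rewrite msuppX inE => /eqP->; exists (pair_of b).2.
  by rewrite inE lt2 andbT -E1 pair_ofP.
by rewrite mnm1E eqxx.
Qed.

Lemma syzygy_exact (x : 'rV[S]_r) : x *m Z = 0 <-> exists y, x = y *m syzygy_mx.
Proof.
split=> [xZ|[y ->]]; last by rewrite -mulmxA syzygy_ker mulmx0.
have [|y _ ->] := @ker_span r x _ xZ; last by exists y.
by move=> l; rewrite leqNgt ltn_ord.
Qed.

End Syzygies.

Definition next_stage s (x : stage s) : stage (stage_rk x) :=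
  Stage (syzygy_homog (@stage_homog _ x) (@stage_quotients _ x))
        (syzygy_quotients (@stage_homog _ x) (@stage_quotients _ x)).

(** The number of columns changes at every step, hence the dependent pair. *)
Fixpoint stages s (x : stage s) (i : nat) : {t : nat & stage t} :=
  if i is i'.+1 then existT _ _ (next_stage (projT2 (stages x i'))) else existT _ s x.

Definition stage_complex (x : stage 1) : free_complex K n :=
  @FreeComplex K n (fun i => stage_rk (projT2 (stages x i)))
    (fun i _ => (stage_deg x + i)%N) (fun i => stage_mx (projT2 (stages x i.+1))) (stage_mx x).

Lemma stage_complex_linear (x : stage 1) : linear_shifts (stage_deg x) (stage_complex x).
Proof. by []. Qed.

Lemma stage_complex_resolution (x : stage 1) J :
  (forall p, J p <-> exists y : 'rV_(stage_rk x), p = (y *m stage_mx x) 0 0) ->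
  minimal_graded_free_resolution (stage_complex x) J.
Proof.
move=> Jx; have hom1 i k t : stage_mx (projT2 (stages x i.+1)) k t \is 1.-homog.
  exact: (@stage_homog _ (projT2 (stages x i.+1))).
split.
- split=> [j m|i j k m mj].
    by have /dhomogP H := @stage_homog _ x j 0; move/H=> /= ->; rewrite addn0.
  by have /dhomogP/(_ m mj)/= -> := hom1 i j k; rewrite add1n addnS.
- split=> // [y|i y]; exact: syzygy_exact.
- move=> i j k; apply: dhomog_nemf_coeff (hom1 i j k) _.
  by rewrite /= mdeg0.
Qed.

Definition monomial_col (w : seq 'X_{1..n}) : 'M[S]_(size w, 1) :=
  \matrix_(k, t) 'X_[nth 0%MM w k].

Lemma in_span_monomial (w : seq 'X_{1..n}) b x :
  in_span (monomial_col w) b x <-> monomial_gen K (fun m => m \in take b w) (x 0 0).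
Proof.
split=> [[y y0 ->]|].
  rewrite mxE; have idM := ideal_gen_ideal (fun p : S => exists2 m, m \in take b w & p = 'X_[m]).
  case: (idM) => M0 _ MM; apply: (ideal_sum idM) => l; rewrite mxE.
  have [bl|lb] := leqP b l; first by rewrite y0 // mul0r.
  apply/MM/ideal_gen_in; exists (nth 0%MM w l) => //.
  by rewrite -(nth_take _ lb) mem_nth // size_take_min leq_min lb ltn_ord.
have -> : x = const_mx (x 0 0) by apply/rowP=> t; rewrite mxE ord1.
rewrite [in X in X -> _]mxE; move: (x 0 0) => p.
apply: (ideal_gen_min (J := fun p => in_span (monomial_col w) b (const_mx p))).
  split=> [|p1 p2|p1 p2].
  - have -> : const_mx 0 = 0 :> 'rV[S]_1 by apply/rowP=> t; rewrite !mxE.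
    exact: in_span0.
  - have -> : const_mx (p1 + p2) = const_mx p1 + const_mx p2 :> 'rV[S]_1.
      by apply/rowP=> t; rewrite !mxE.
    exact: in_spanD.
  - have -> : const_mx (p1 * p2) = p1 *: const_mx p2 :> 'rV[S]_1.
      by apply/rowP=> t; rewrite !mxE.
    exact: in_spanZ.
move=> _ [m mw ->]; have lt_m : (index m w < size w)%N by rewrite index_mem (mem_take mw).
have -> : const_mx 'X_[m] = row (Ordinal lt_m) (monomial_col w).
  by apply/rowP=> t; rewrite !mxE nth_index ?(mem_take mw).
by apply: in_span_row; apply: index_ltn.
Qed.

Lemma linear_quotients_resolution J (A : 'X_{1..n} -> Prop) d :
  (forall p, J p <-> monomial_gen K A p) -> (forall w, A w -> mdeg w = d) ->
  linear_quotients J -> linear_resolution J.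
Proof.
move=> JA Ad [_ [w [w_uniq w_min w_col]]].
have wA m : m \in w <-> A m by rewrite w_min; apply: min_monomial_genE JA Ad m.
have Jw p : J p <-> exists y : 'rV_(size w), p = (y *m monomial_col w) 0 0.
  have -> : J p <-> monomial_gen K (fun m => m \in take (size w) w) p.
    by rewrite JA take_size; split; apply: ideal_gen_sub => _ [m mA ->]; exists m => //; apply/wA.
  split=> [H|[y ->]].
    have [|y _ Ey] := (in_span_monomial w (size w) (const_mx p)).2; first by rewrite mxE.
    by exists y; rewrite -Ey mxE.
  by apply/in_span_monomial; exists y => // l; rewrite leqNgt ltn_ord.
have col_homog k t : monomial_col w k t \is d.-homog.
  by rewrite mxE dhomogX /=; apply/eqP/Ad/wA/mem_nth.
have quot (k : 'I_(size w)) : exists B : {set 'I_n}, forall p,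
    in_span (monomial_col w) k (p *: row k (monomial_col w)) <-> in_vars B p.
  have [k0|k_gt0] := posnP k; last first.
    have [|B HB] := w_col k; first by rewrite k_gt0 ltn_ord.
    by exists B => p; rewrite in_varsP -HB in_span_monomial /colon !mxE.
  (* For the first generator the colon ideal is zero, generated by the empty set of variables. *)
  exists set0 => p; rewrite in_span_monomial !mxE k0 take0 monomial_genP; split=> H m.
    move=> mp; have [|l //] := H (nth 0%MM w 0 + m)%MM.
    by rewrite (perm_mem (msuppMX p _)) map_f.
  by rewrite (perm_mem (msuppMX p _)) => /mapP[m' /H[j]]; rewrite inE.
have [B HB] := fin_all_exists quot.
pose x := Stage col_homog HB; exists d; split.
  exists (fun p => exists2 m, A m & p = 'X_[m]); split; last exact: JA.
  by move=> _ [m /Ad <- ->]; rewrite dhomogX.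
by exists (stage_complex x); split; [apply: stage_complex_resolution|apply: stage_complex_linear].
Qed.

End LinearQuotientModules.

(** * The Koszul complex *)

Section Koszul.
Local Open Scope ring_scope.
Variables (K : fieldType) (n : nat).
Local Notation S := {mpoly K[n]}.
Implicit Types (T A B : {set 'I_n}) (t s i : 'I_n) (p : S).

(** The sign of [x_t e_T] in the boundary of [e_(t |: T)]. *)
Definition ksign t T : S := (-1) ^+ #|[set s in T | (s < t)%N]|.

(* A Koszul chain is given by its coefficients at the exterior monomials [e_T]. *)
Definition kbd r (f : {set 'I_n} -> 'rV[S]_r) T : 'rV[S]_r :=
  \sum_(t | t \notin T) (ksign t T * 'X_t) *: f (t |: T).

Lemma ksign_gt t s T : (t <= s)%N -> ksign t (s |: T) = ksign t T.
Proof.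
move=> ts; rewrite /ksign; congr (_ ^+ #|pred_of_set _|); apply/setP=> i.
by rewrite !inE; case: eqP => [->|//]; rewrite [(s < t)%N]ltnNge ts /= !andbF.
Qed.

Lemma ksign_lt t s T : (s < t)%N -> s \notin T -> ksign t (s |: T) = - ksign t T.
Proof.
move=> st sT; rewrite /ksign.
have -> : [set i in s |: T | (i < t)%N] = s |: [set i in T | (i < t)%N].
  by apply/setP=> i; rewrite !inE; case: eqP => [->|].
by rewrite cardsU1 inE (negbTE sT) exprS mulN1r.
Qed.

Lemma ksign_swap t s T : t != s -> t \notin T -> s \notin T ->
  ksign t T * ksign s (t |: T) = - (ksign s T * ksign t (s |: T)).
Proof.
move=> ts tT sT; case: (ltngtP t s) => [lt|lt|/val_inj E].
- by rewrite ksign_lt // (ksign_gt _ (ltnW lt)) mulrN mulrC.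
- by rewrite (ksign_lt lt) // ksign_gt 1?ltnW // mulrN opprK mulrC.
- by rewrite E eqxx in ts.
Qed.

Section Rows.
Variable r : nat.
Implicit Types f g k : {set 'I_n} -> 'rV[S]_r.

Lemma eq_kbd f g T : (forall B, B != set0 -> f B = g B) -> kbd f T = kbd g T.
Proof.
move=> fg; apply: eq_bigr => t _; congr (_ *: _); apply: fg.
by apply/set0Pn; exists t; rewrite setU11.
Qed.

Lemma kbdD f g T : kbd (fun B => f B + g B) T = kbd f T + kbd g T.
Proof. by rewrite -big_split; apply: eq_bigr => t _; rewrite scalerDr. Qed.

Lemma kbdB f g T : kbd (fun B => f B - g B) T = kbd f T - kbd g T.
Proof. by rewrite -sumrB; apply: eq_bigr => t _; rewrite scalerBr. Qed.

Lemma kbd_mulmx (c : nat) (D : 'M[S]_(r, c)) f T : kbd (fun B => f B *m D) T = kbd f T *m D.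
Proof. by rewrite mulmx_suml; apply: eq_bigr => t _; rewrite scalemxAl. Qed.

Lemma kbd_kbd f T : kbd (kbd f) T = 0.
Proof.
pose F t s := (ksign t T * 'X_t * (ksign s (t |: T) * 'X_s)) *: f (s |: (t |: T)).
pose P t s := [&& t \notin T, s \notin T & (t < s)%N].
(* The double sum is split by the order of the two indices; the halves cancel by [ksign_swap]. *)
have -> : kbd (kbd f) T = \sum_t \sum_(s | P t s) F t s + \sum_t \sum_(s | P s t) F t s.
  rewrite -big_split /kbd big_mkcond; apply: eq_bigr => t _ /=.
  case: (boolP (t \in T)) => tT /=.
    by rewrite !big_pred0 ?addr0 // => s; rewrite /P tT ?andbF.
  rewrite scaler_sumr (bigID (fun s => t < s)%N) /=; congr (_ + _).
    apply: eq_big => [s|s _]; last by rewrite scalerA.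
    by rewrite /P tT !inE negb_or /=; have [->|_] := eqVneq s t; rewrite ?ltnn ?andbF.
  apply: eq_big => [s|s _]; last by rewrite scalerA.
  rewrite /P tT !inE negb_or /=; have [->|] := eqVneq s t; first by rewrite ltnn !andbF.
  by rewrite -leqNgt [in RHS]ltn_neqAle -val_eqE => ->.
rewrite [X in _ + X](exchange_big_dep xpredT) //= -big_split big1 // => t _.
rewrite -big_split big1 // => s /=.
case/and3P=> tT sT ts; rewrite /F setUCA -scalerDl.
have -> : ksign t T * 'X_t * (ksign s (t |: T) * 'X_s) =
    (ksign t T * ksign s (t |: T)) * ('X_t * 'X_s) by rewrite mulrACA.
have -> : ksign s T * 'X_s * (ksign t (s |: T) * 'X_t) =
    (ksign s T * ksign t (s |: T)) * ('X_t * 'X_s) by rewrite mulrACA ['X_s * _]mulrC.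
by rewrite ksign_swap // ?neq_ltn ?ts // mulNr addNr scale0r.
Qed.

Definition single (q : 'I_n -> 'rV[S]_r) T := \sum_t (if T == [set t] then q t else 0).

Lemma single1 q t : single q [set t] = q t.
Proof.
rewrite /single (bigD1 t) //= eqxx big1 ?addr0 // => s st.
by case: eqP => // /set1_inj E; rewrite E eqxx in st.
Qed.

Lemma single0 q T : #|T| != 1%N -> single q T = 0.
Proof. by move=> T1; apply: big1 => t _; case: eqP => // E; rewrite E cards1 eqxx in T1. Qed.

Lemma kbd_single0 q : kbd (single q) set0 = \sum_t 'X_t *: q t.
Proof.
apply: eq_big => [t|t _]; first by rewrite inE.
rewrite setU0 single1 /ksign [X in #|pred_of_set X|](_ : _ = set0) ?cards0 ?mul1r //.
by apply/setP=> s; rewrite !inE.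
Qed.

Lemma kbd_single q T : T != set0 -> kbd (single q) T = 0.
Proof.
move=> T0; apply: big1 => t tT.
by rewrite single0 ?scaler0 // cardsU1 tT add1n eqSS cards_eq0.
Qed.

Lemma in_vars_sum A p : in_vars A p -> exists q : 'I_n -> S, p = \sum_(t in A) q t * 'X_t.
Proof.
apply: (vars_ind (P := fun p => exists q : 'I_n -> S, p = \sum_(t in A) q t * 'X_t)).
  split.
  - by exists (fun=> 0); rewrite big1 // => t _; rewrite mul0r.
  - move=> _ _ [q1 ->] [q2 ->]; exists (fun t => q1 t + q2 t).
    by rewrite -big_split; apply: eq_bigr => t _; rewrite mulrDl.
  - move=> p1 _ [q ->]; exists (fun t => p1 * q t).
    by rewrite mulr_sumr; apply: eq_bigr => t _; rewrite mulrA.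
move=> j jA; exists (fun t => (t == j)%:R); rewrite (bigD1 j) //= eqxx mul1r big1 ?addr0 //.
by move=> t /andP[_ /negbTE->]; rewrite mul0r.
Qed.

Lemma row_in_vars A (c : 'rV[S]_r) : (forall l, in_vars A (c 0 l)) ->
  exists q : 'I_n -> 'rV[S]_r, [/\ forall t, t \notin A -> q t = 0 & c = \sum_t 'X_t *: q t].
Proof.
move=> cA; have [q Eq] := fin_all_exists (fun l => in_vars_sum (cA l)).
exists (fun t => if t \in A then \row_l q l t else 0); split=> [t /negbTE->//|].
apply/rowP=> l; rewrite summxE Eq big_mkcond; apply: eq_bigr => t _.
by rewrite mxE; case: (t \in A); rewrite mxE ?mulr0 // mulrC.
Qed.

(** * Exactness of the Koszul complex in positive degree *)

Definition below b : {set 'I_n} := [set s : 'I_n | (s < b)%N].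

Definition below_supp b f := forall T, ~~ (T \subset below b) -> f T = 0.

Lemma subset_belowS b (bn : (b < n)%N) T :
  (T \subset below b.+1) && (Ordinal bn \notin T) = (T \subset below b).
Proof.
apply/andP/idP=> [[/subsetP Tb iT]|/subsetP Tb]; last split.
- apply/subsetP=> s sT; have := Tb s sT; rewrite !inE ltnS leq_eqVlt => /predU1P[E|//].
  by rewrite (_ : Ordinal bn = s) ?sT // in iT; apply/val_inj.
- by apply/subsetP=> s /Tb; rewrite !inE => /ltnW.
- by apply/negP=> /Tb; rewrite inE ltnn.
Qed.

Lemma kbd_below b f T : below_supp b f -> ~~ (T \subset below b) -> kbd f T = 0.
Proof.
move=> f_supp Tb; apply: big1 => t _; rewrite f_supp ?scaler0 //.
by apply: contra Tb; apply: subset_trans; apply: subsetUr.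
Qed.

(** On the first [b + 1] variables, [contract] takes the coefficient of the last exterior generator
    and [wedge] multiplies by it. As this generator is the last, contraction commutes with the
    boundary without a sign. *)
Definition contract i f T := if i \in T then 0 else f (i |: T).

Lemma kbd_contract b (bn : (b < n)%N) f T : below_supp b.+1 f -> Ordinal bn \notin T ->
  kbd f (Ordinal bn |: T) = kbd (contract (Ordinal bn) f) T.
Proof.
set i := Ordinal bn => f_supp iT;
rewrite [RHS](bigD1 i) //= [contract i f (i |: T)]/contract setU11 scaler0 add0r.
apply: eq_big => [t|t]; first by rewrite !inE negb_or andbC.
rewrite !inE negb_or => /andP[ti tT]; rewrite /contract !inE (negbTE iT) orbF eq_sym (negbTE ti).
rewrite setUCA; have [ti'|it] := leqP t i; first by rewrite ksign_gt.
rewrite f_supp ?scaler0 //; apply/negP=> /subsetP/(_ t).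
by rewrite !inE eqxx orbT ltnS leqNgt it => /(_ isT).
Qed.

Definition wedge i f T := if i \in T then f (T :\ i) else 0.

Lemma wedge_below b (bn : (b < n)%N) f : below_supp b f -> below_supp b.+1 (wedge (Ordinal bn) f).
Proof.
move=> f_supp T Tb; rewrite /wedge; case: ifP => // iT; apply: f_supp.
apply: contra Tb => /subsetP Tb; apply/subsetP=> s sT; rewrite inE ltnS.
have [E|si] := eqVneq s (Ordinal bn); first by rewrite E.
by apply: ltnW; have := Tb s; rewrite !inE si sT; apply.
Qed.

Lemma contract_wedge b (bn : (b < n)%N) f T : below_supp b f ->
  contract (Ordinal bn) (wedge (Ordinal bn) f) T = f T.
Proof.
move=> f_supp; rewrite /contract /wedge; case: ifP => [iT|/negbT iT].
  by rewrite f_supp // -(subset_belowS bn) iT andbF.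
by rewrite setU11 setU1K.
Qed.

Lemma kbd_wedge i f T : i \notin T -> kbd (wedge i f) T = (ksign i T * 'X_i) *: f T.
Proof.
move=> iT; rewrite /kbd (bigD1 i) //= [wedge i f (i |: T)]/wedge setU11 setU1K //.
rewrite big1 ?addr0 // => t /andP[tT ti].
by rewrite /wedge !inE (negbTE iT) orbF eq_sym (negbTE ti) scaler0.
Qed.

Lemma ksign0 t : ksign t set0 = 1.
Proof.
rewrite /ksign (_ : [set _ in _ | _] = set0) ?cards0 //.
by apply/setP=> s; rewrite !inE.
Qed.

(* [x_b] is regular modulo the smaller variables. *)
Lemma contract_in_vars b (bn : (b < n)%N) f : below_supp b.+1 f -> kbd f set0 = 0 ->
  forall l, in_vars (below b) (f [set Ordinal bn] 0 l).
Proof.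
set i := Ordinal bn => f_supp bf l; apply: (@mulX_in_vars _ _ _ i); last by rewrite inE ltnn.
have idV := in_vars_ideal K (below b).
have -> : f [set i] 0 l * 'X_i = \sum_(t : 'I_n | t != i) - f [set t] 0 l * 'X_t.
  have := congr1 (fun x : 'rV[S]_r => x 0 l) bf; rewrite /kbd (bigD1 i) ?inE //=.
  rewrite setU0 ksign0 mul1r mxE summxE !mxE mulrC => /eqP; rewrite addr_eq0 => /eqP->.
  rewrite -sumrN; apply: eq_big => [t|t _]; first by rewrite inE.
  by rewrite mxE setU0 ksign0 mul1r mulrC mulNr.
rewrite big_mkcond; case: (idV) => v0 _ vM; apply: (ideal_sum idV) => t.
case: ifP => // ti; have [tb|bt] := boolP (t \in below b).
  by apply: vM => m; rewrite msuppX inE => /eqP->; exists t; rewrite // mnm1E eqxx.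
rewrite f_supp ?mxE ?oppr0 ?mul0r //; apply: contra bt => tb.
have : [set t] \subset below b by rewrite -(subset_belowS bn) tb inE eq_sym ti.
by rewrite sub1set.
Qed.

(** Induction on the number of variables. The coefficient [f1] of the last exterior generator is a
    cycle, and its part of degree 0 lies in the ideal of the earlier variables, so [f1] is the
    boundary of some [k1]. Subtracting the boundary of [wedge i k1] from [f] removes that
    generator. *)
Lemma koszul_exact_below b f : below_supp b f -> f set0 = 0 -> (forall T, kbd f T = 0) ->
  exists k, [/\ below_supp b k, k set0 = 0 & forall T, f T = kbd k T].
Proof.
elim: b f => [|b IH] f f_supp f0 bf.
  exists (fun=> 0); split=> // T; rewrite [RHS]big1 => [|t _]; last by rewrite scaler0.
  have [->//|T0] := eqVneq T set0; apply: f_supp.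
  apply: contra T0 => /subsetP T0; apply/eqP/setP=> i.
  by rewrite inE; apply/negP=> /T0; rewrite inE.
have [bn|nb] := ltnP b n; last first.
  have full T : T \subset below b.
    by apply/subsetP=> i _; rewrite inE (leq_trans (ltn_ord i)).
  have [|k [k_supp k0 Ek]] := IH f _ f0 bf; first by move=> T; rewrite full.
  exists k; split=> // T /negP[]; apply: subset_trans (full T) _.
  by apply/subsetP=> i; rewrite !inE => /ltnW.
pose i := Ordinal bn; pose f1 := contract i f.
have f1_supp : below_supp b f1.
  move=> T; rewrite -(subset_belowS bn) negb_and negbK /f1 /contract.
  case: ifP => // iT; rewrite orbF => Tb; apply: f_supp; apply: contra Tb.
  by apply: subset_trans; apply: subsetUr.
have bf1 T : kbd f1 T = 0.
  case: (boolP (T \subset below b)) => Tb; last exact: kbd_below Tb.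
  by move: Tb; rewrite -(subset_belowS bn) => /andP[_ iT]; rewrite -kbd_contract.
have f1_0 : f1 set0 = f [set i] by rewrite /f1 /contract inE setU0.
have [q [q0 Eq]] : exists q,
    [/\ forall t, t \notin below b -> q t = 0 & f1 set0 = \sum_t 'X_t *: q t].
  by apply: row_in_vars; rewrite f1_0; apply: contract_in_vars.
have q_supp : below_supp b (single q).
  move=> T Tb; have [/cards1P[t Et]|T1] := boolP (#|T| == 1%N); last exact: single0.
  by rewrite Et sub1set in Tb *; rewrite single1 q0.
have [T T_|||k1' [k1_supp k1_0 Ek1]] := IH (fun T => f1 T - kbd (single q) T).
- by rewrite f1_supp // (kbd_below q_supp) // subrr.
- by rewrite kbd_single0 -Eq subrr.
- by move=> T; rewrite kbdB bf1 kbd_kbd subrr.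
pose k1 T := single q T + k1' T.
have k1_b : below_supp b k1 by move=> T Tb; rewrite /k1 q_supp // k1_supp // addr0.
have k1_set0 : k1 set0 = 0 by rewrite /k1 k1_0 single0 ?cards0 ?addr0.
have Ef1 T : f1 T = kbd k1 T by rewrite kbdD -Ek1 addrC subrK.
pose w := wedge i k1; have w_supp : below_supp b.+1 w by apply: wedge_below.
have [T Tb|||k2 [k2_supp k2_0 Ek2]] := IH (fun T => f T - kbd w T).
- have [iT|iT] := boolP (i \in T).
    rewrite -(setD1K iT) kbd_contract // ?inE ?eqxx //.
    rewrite (eq_kbd (g := k1)) => [|B _]; last exact: contract_wedge.
    by rewrite -Ef1 /f1 /contract !inE eqxx subrr.
  rewrite kbd_wedge // k1_b // scaler0 subr0 f_supp //.
  by apply: contra Tb => Tb; rewrite -(subset_belowS bn) Tb.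
- by rewrite kbd_wedge ?inE // f0 k1_set0 scaler0 subrr.
- by move=> T; rewrite kbdB bf kbd_kbd subrr.
exists (fun T => k2 T + w T); split=> [T Tb||T].
- rewrite w_supp // k2_supp ?addr0 //; apply: contra Tb.
  by rewrite -(subset_belowS bn) => /andP[].
- by rewrite k2_0 /w /wedge inE addr0.
- by rewrite kbdD -Ek2 subrK.
Qed.

Lemma koszul_exact f : f set0 = 0 -> (forall T, kbd f T = 0) ->
  exists k, forall T, f T = kbd k T.
Proof.
move=> f0 bf; have [T|k [_ _ Ek]] := @koszul_exact_below n f _ f0 bf; last by exists k.
by move/negP; case; apply/subsetP=> i _; rewrite inE ltn_ord.
Qed.

End Rows.
End Koszul.

(** * A linear resolution implies the Koszul condition *)

Section KoszulCondition.
Local Open Scope ring_scope.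
Variables (K : fieldType) (n : nat).
Local Notation S := {mpoly K[n]}.
Implicit Types (T B : {set 'I_n}) (t i : 'I_n) (p : S).

Lemma ksign_mul_homog t T p d : p \is d.-homog -> ksign K t T * p \is d.-homog.
Proof.
by move=> ph; rewrite /ksign -signr_odd; case: odd; rewrite ?expr0 ?expr1 ?mulN1r ?mul1r ?rpredN.
Qed.

Lemma kbd_homog r (f : {set 'I_n} -> 'rV[S]_r) d T l :
  (forall B l, f B 0 l \is d.-homog) -> kbd f T 0 l \is (d + 1).-homog.
Proof.
move=> fh; rewrite summxE; apply: rpred_sum => t _; rewrite mxE -mulrA.
apply: ksign_mul_homog; rewrite addnC.
by apply: dhomogM; rewrite // dhomogX /= mdeg1.
Qed.

(** Vanishing of the Koszul homology, in homological degree [c], of the module generated by the rows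
    of [D]; the condition [0 < d] leaves out the degree of the generators. *)
Definition koszul_linear c r s (D : 'M[S]_(r, s)) :=
  forall (d : nat) (f : {set 'I_n} -> 'rV[S]_r), (0 < d)%N -> (forall T, #|T| != c -> f T = 0) ->
  (forall T l, f T 0 l \is d.-homog) -> (forall T, kbd (fun B => f B *m D) T = 0) ->
  exists k : {set 'I_n} -> 'rV[S]_r, forall T, f T *m D = kbd (fun B => k B *m D) T.

(** Coefficients of positive degree lie in the ideal of all variables. *)
Lemma koszul_linear0 r s (D : 'M[S]_(r, s)) : koszul_linear 0 D.
Proof.
move=> d f d_gt0 f_supp fh _.
have [|q [_ Eq]] := @row_in_vars K n r setT (f set0).
  move=> l m ml; have /dhomogP/(_ m ml)/= dm := fh set0 l.
  have [j _ lt_j] : exists2 j, xpredT j & ((0%MM : 'X_{1..n}) j < m j)%N.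
    by apply: mdeg_lt_ex; rewrite ?mdeg0 ?dm.
  by exists j; rewrite ?inE // -(mnm0E j).
exists (single q) => T; rewrite kbd_mulmx; congr (_ *m D).
have [->|T0] := eqVneq T set0; first by rewrite kbd_single0.
by rewrite kbd_single // f_supp // cards_eq0.
Qed.

(* Dimension shifting along [0 -> ker D -> S^r -> im D -> 0]. *)
Lemma koszul_linearS c r s r' (D : 'M[S]_(r, s)) (E : 'M[S]_(r', r)) :
  (forall x : 'rV_r, x *m D = 0 <-> exists y, x = y *m E) ->
  (forall k l, E k l \is 1.-homog) -> koszul_linear c E -> koszul_linear c.+1 D.
Proof.
move=> exDE Eh linE d f d_gt0 f_supp fh bf.
(* The boundary of [f] lies in the kernel of [D]. It lifts through [E] with coefficients of degree
   [d] again, because the entries of [E] are linear. *)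
have lift T : exists y : 'rV[S]_r',
    [/\ kbd f T = y *m E, #|T| != c -> y = 0 & forall l, y 0 l \is d.-homog].
  have [Tc|Tc] := eqVneq #|T| c.
    have [y Ey] : exists y, kbd f T = y *m E by apply/exDE; rewrite -kbd_mulmx.
    exists (\row_l pihomog mdeg d (y 0 l)); split=> // [|l]; last by rewrite mxE pihomogP.
    rewrite Ey; apply: pihomog_mulmx => // t; rewrite -Ey; exact: kbd_homog.
  exists 0; split=> // [|l]; last by rewrite mxE rpred0.
  by rewrite mul0mx; apply: big1 => t tT; rewrite f_supp ?scaler0 // cardsU1 tT add1n eqSS.
have [g Eg] := fin_all_exists lift.
have [|||h Eh'] := linE d g d_gt0.
- by move=> T; case: (Eg T).
- by move=> T l; case: (Eg T).
- move=> T; rewrite -[RHS](kbd_kbd f T); apply: eq_bigr => t _.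
  by case: (Eg (t |: T)) => ->.
(* Clearing the coefficient at the empty set does not change the boundary, and it allows
   [koszul_exact] to be applied to [f - h' E]. *)
pose h' T := if T == set0 then 0 else h T.
have Ebd T : kbd f T = kbd (fun B => h' B *m E) T.
  case: (Eg T) => -> _ _; rewrite Eh'; apply: eq_kbd => B /negbTE B0.
  by rewrite /h' B0.
have [||k Ek] := @koszul_exact K n r (fun T => f T - h' T *m E).
- by rewrite f_supp ?cards0 // /h' eqxx mul0mx subrr.
- by move=> T; rewrite kbdB Ebd subrr.
exists k => T; rewrite kbd_mulmx -Ek mulmxBl.
have -> : h' T *m E *m D = 0 by apply/exDE; exists (h' T).
by rewrite subr0.
Qed.

(** The cycle [d (x^m e_B)] has coefficients in [J] of degree above [d], so it is the boundary of a
    chain over [J]; the claim is read off at the exterior monomial of [B :\ i]. *)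
Lemma linear_resolution_koszul (J : S -> Prop) (A : 'X_{1..n} -> Prop) d :
  (forall p, J p <-> monomial_gen K A p) -> (forall w, A w -> mdeg w = d) ->
  linear_resolution J -> koszul_condition d A.
Proof.
move=> JA Ad [e [[G [Gh JG]] [F [[F_graded [F_aug F_ex0 F_ex] F_min] F_lin]]]].
have JX w : A w -> J 'X_[w] by move=> Aw; apply/JA/monomial_genX/divby_refl.
move=> B m dm divB i iB.
(* The degree in [linear_resolution] is only asserted to exist; degrees in the supports of
   generators identify it. *)
have Ee : e = d.
  have [w Aw _] := divB i iB; apply/eqP; rewrite eqn_leq; apply/andP; split.
    have supp_e : forall m', m' \in msupp ('X_[w] : S) -> (e <= mdeg m')%N.
      apply: (ideal_gen_min (J := fun p => forall m', m' \in msupp p -> (e <= mdeg m')%N))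
        ((JG _).1 (JX w Aw)).
        by apply: supported_ideal => m1 m2; rewrite mdegD => /leq_trans; apply; rewrite leq_addl.
      by move=> g /Gh/dhomogP gh m' /gh /= ->.
    by rewrite -(Ad w Aw); apply: supp_e; rewrite msuppX inE.
  have supp_d : forall m', m' \in msupp ('X_[w] : S) -> (d <= e)%N.
    apply: (ideal_gen_min (J := fun p => forall m', m' \in msupp p -> (d <= e)%N))
      ((JG _).1 (JX w Aw)).
      by apply: supported_ideal.
    move=> g Gg m' gm'; have /JA/monomial_genP/(_ m' gm')[l Al lm'] : J g.
      by apply/JG/ideal_gen_in.
    by have /dhomogP/(_ m' gm')/= <- := Gh g Gg; rewrite -(Ad l Al) mdeg_le.
  by apply: (supp_d w); rewrite msuppX inE.
subst e; case: F_graded => aug_graded dif_graded.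
have aug_homog k l : aug F k l \is d.-homog.
  by apply/dhomogP=> m'; rewrite ord1 => /aug_graded /= ->; rewrite F_lin addn0.
have dif_homog a k l : dif F a k l \is 1.-homog.
  by apply/dhomogP=> m' /dif_graded; rewrite !F_lin /=; lia.
(* Each step down in homological degree moves one step along the resolution. *)
have lin_dif c a : koszul_linear c (dif F a).
  elim: c a => [|c IH] a; first exact: koszul_linear0.
  exact: koszul_linearS (F_ex a) (dif_homog a.+1) (IH a.+1).
have lin_aug c : koszul_linear c (aug F).
  case: c => [|c]; first exact: koszul_linear0.
  exact: koszul_linearS F_ex0 (dif_homog 0%N) (lin_dif c 0%N).
have idJ : is_ideal J.
  have [J0 JD JM] := ideal_gen_ideal (fun p : S => exists2 w, A w & p = 'X_[w]).
  split; first exact/JA.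
  - by move=> p q /JA Jp /JA Jq; apply/JA/JD.
  - by move=> p q /JA Jq; apply/JA/JM.
pose Y T : 'rV[S]_1 := if T == B then const_mx 'X_[m] else 0.
have Y0 T : T != B -> Y T = 0 by rewrite /Y => /negbTE->.
(* The coefficients of the cycle are lifted to [F_0]; the degree [mdeg m + 1 - d] is positive as
   [d <= mdeg m]. *)
have lift T : exists x : 'rV_(rk F 0), [/\ kbd Y T = x *m aug F, #|T| != #|B|.-1 -> x = 0 &
    forall l, x 0 l \is (mdeg m + 1 - d).-homog].
  have [TB|TB] := eqVneq #|T| #|B|.-1; last first.
    exists 0; split=> // [|l]; last by rewrite mxE rpred0.
    rewrite mul0mx; apply: big1 => t tT; rewrite Y0 ?scaler0 //; apply: contraNneq TB => <-.
    by rewrite cardsU1 tT.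
  have : J (kbd Y T 0 0).
    rewrite summxE; case: (idJ) => J0 JD JM; apply: (big_ind J) => // t tT.
    rewrite mxE /Y; case: eqP => [E|_]; last by rewrite mxE mulr0.
    rewrite mxE -mulrA; apply: JM; rewrite -mpolyXD; apply/JA/monomial_genX.
    by rewrite addmC; apply: divB; rewrite -E setU11.
  case/F_aug=> x Ex; have Ex' : kbd Y T = x *m aug F by apply/rowP=> l; rewrite ord1.
  exists (\row_l pihomog mdeg (mdeg m + 1 - d) (x 0 l)); split=> // [|l].
    rewrite Ex'; apply: pihomog_mulmx => // t; rewrite -Ex' subnK; last by rewrite addn1 ltnW.
    apply: kbd_homog => B' l; rewrite /Y; case: eqP => _; last by rewrite mxE rpred0.
    by rewrite mxE dhomogX.
  by rewrite mxE pihomogP.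
have [f Ef] := fin_all_exists lift.
have [||||k Ek] := lin_aug #|B|.-1 (mdeg m + 1 - d)%N f.
- by rewrite subn_gt0 addn1.
- by move=> T; case: (Ef T).
- by move=> T l; case: (Ef T).
- move=> T; rewrite -[RHS](kbd_kbd Y T); apply: eq_bigr => t _.
  by case: (Ef (t |: T)) => ->.
pose C := B :\ i.
(* In the boundary of [x^m e_B], only [t = i] contributes at [C]. *)
have EC : ksign K i C * 'X_[U_(i) + m] =
    \sum_(t | t \notin C) ksign K t C * 'X_t * (k (t |: C) *m aug F) 0 0.
  have := congr1 (fun x : 'rV[S]_1 => x 0 0) (Ek C).
  rewrite summxE; case: (Ef C) => <- _ _; rewrite /kbd (bigD1 i) ?setD11 //= big1 ?addr0.
    rewrite setD1K // /Y eqxx !mxE -mulrA -mpolyXD => ->.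
    by apply: eq_bigr => t _; rewrite !mxE.
  move=> t /andP[tC ti]; rewrite Y0 ?scaler0 //; apply: contraNneq tC => E.
  by rewrite !inE ti -E setU11.
(* Membership of a monomial in the ideal generated by the [x_t J] with [t] outside [C]; the index
   [t = i] will give that [m] itself is divisible. *)
pose P (m' : 'X_{1..n}) := exists t, [/\ t \notin C, (0 < m' t)%N & divby A (m' - U_(t))%MM].
have P_up (m1 m2 : 'X_{1..n}) : P m1 -> P (m2 + m1)%MM.
  case=> t [tC m_t divt]; exists t; split=> //; first by rewrite mnmDE addn_gt0 m_t orbT.
  by rewrite -addmBA ?lep1mP -?lt0n //; apply: divby_add.
have P_mulX t p : t \notin C -> J p -> forall m', m' \in msupp ('X_t * p) -> P m'.
  move=> tC /JA/monomial_genP Jp m'; rewrite mulrC (perm_mem (msuppMX p _)).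
  case/mapP=> m1 /Jp divm1 ->.
  exists t; split=> //; first by rewrite mnmDE mnm1E eqxx.
  by rewrite addmC addmK.
have [t [tC m_t divt]] : P (U_(i) + m)%MM.
  suff : forall m', m' \in msupp ('X_[U_(i) + m] : S) -> P m' by apply; rewrite msuppX inE.
  have -> : 'X_[U_(i) + m] = ksign K i C * (ksign K i C * 'X_[U_(i) + m]).
    by rewrite mulrA -expr2 /ksign sqrr_sign mul1r.
  have [P0 PD PM] := supported_ideal K P_up.
  apply: (PM); rewrite EC; apply: (big_ind (fun p => forall m', m' \in msupp p -> P m')) => // t tC.
  rewrite -mulrA; apply: (PM); apply: P_mulX => //.
  by apply/F_aug; exists (k (t |: C)).
have [ti|ti] := eqVneq t i; first by left; move: divt; rewrite ti addmC addmK.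
right; exists t; split.
- by move: tC; rewrite !inE ti.
- by move: m_t; rewrite mnmDE mnm1E eq_sym (negbTE ti).
- by rewrite /move addmC.
Qed.

End KoszulCondition.

(** * The cycle of implications between the four statements *)

Local Open Scope ring_scope.

Theorem theorem1 (K : fieldType) (n d : nat) (hd : (2 <= d)%N)
    (u v : 'X_{1..n.+1}) (hu : mdeg u = d) (hv : mdeg v = d)
    (hu1 : (0 < u ord0)%N) (huv : lexm v u) :
  let I := lexsegment_ideal K u v in
  [<-> linear_resolution I;
       linear_quotients I;
       forall N : nat, (1 <= N)%N -> linear_quotients (ideal_pow I N);
       forall N : nat, (1 <= N)%N -> linear_resolution (ideal_pow I N)].
Proof.
move=> I; pose L w : Prop := w \in lexsegment u v.
have L_deg w : L w -> mdeg w = d by rewrite /L -hu => /and3P[/eqP].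
have I_L p : I p <-> monomial_gen K L p by [].
have IN_L N p : ideal_pow I N p <-> monomial_gen K (mpow L N) p := ideal_pow_monomial L N p.
have I1_L p : ideal_pow I 1 p <-> monomial_gen K L p.
  by rewrite IN_L; split; apply: ideal_gen_sub => _ [w /mpow1 Lw ->]; exists w.
have LN_deg N w : mpow L N w -> mdeg w = (N * d)%N by apply: mdeg_mpow.
have L_enum : exists s : seq 'X_{1..n.+1}, forall m, m \in s <-> L m.
  exists [seq bmnm m | m in [pred m : 'X_{1..n.+1 < d.+1} | bmnm m \in lexsegment u v]] => m.
  split=> [/imageP[m' /= Lm' ->]//|Lm]; apply/imageP.
  have lt_m : (mdeg m < d.+1)%N by rewrite (L_deg m Lm).
  by exists (BMultinom lt_m).
(* Stated for every predicate [J] with the same generators, since [ideal_pow I 1] agrees with [I]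
   only pointwise. *)
have powers J : (forall p, J p <-> monomial_gen K L p) -> linear_resolution J ->
    forall N, linear_quotients (ideal_pow I N).
  move=> JL /(linear_resolution_koszul JL L_deg) kos N.
  have [|le [le_lin exch]] := @lexsegment_order n u v (etrans hu (esym hv)) huv.
    by rewrite hu.
  have [s sL] := mpow_enum N L_enum.
  exact: linear_quotients_order (IN_L N) (LN_deg N) sL le_lin (exch N).
have quotients J : (forall p, J p <-> monomial_gen K L p) -> linear_resolution J ->
    linear_quotients I.
  move=> JL /(powers J JL)/(_ 1%N) [_ [w [w_uniq w_min w_col]]]; split; first by exists L.
  exists w; split=> // m; rewrite w_min.
  by rewrite (min_monomial_genE I1_L L_deg) (min_monomial_genE I_L L_deg).
tfae.
- exact: quotients.
(* The passage to powers goes through the linear resolution of [I]. *)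
- move=> /(linear_quotients_resolution I_L L_deg)/(powers I I_L) LQ N _; exact: LQ.
- by move=> LQ N N1; apply: linear_quotients_resolution (IN_L N) (LN_deg N) (LQ N N1).
- move=> /(_ 1%N isT)/(quotients _ I1_L); exact: linear_quotients_resolution I_L L_deg.
Qed.
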